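(* Let $m,n\ge0$ be integers and $R\in\mathbb{C}[\mathcal{E}]\otimes Z(U(\mathfrak{gl}(m|n)))$, and write $\varphi=\varphi_R$. Then $$\varphi|_{Z(U(\mathfrak{gl}(m+1|n)))}=\chi_{0,m|n}^{-1}\circ\tau\circ\chi_{m+1|n}.$$ In particular, $\varphi(Z(U(\mathfrak{gl}(m+1|n))))$ is a subalgebra of $\mathbb{C}[\mathcal{E}]\otimes Z(U(\mathfrak{gl}(m|n)))$, and $\chi_{0,m|n}\circ\varphi=\tau\circ\chi_{m+1|n}$ as maps $Z(U(\mathfrak{gl}(m+1|n)))\to\mathbb{C}[\ell_0]\otimes I(\mathfrak{h}_{m|n})$.
   Context: Everything is over $\mathbb{C}$ and $\mathbb{Z}/2$-graded. Let $I=\{1,\dots,m,\bar 1,\dots,\bar n\}$ and $\hat I=\{0\}\cup I$, ordered by $0<1<\dots<m<\bar1<\dots<\bar n$, with parity $|i|=0$ for unbarred and $|i|=1$ for barred indices. $\mathfrak{gl}(m+1|n)$ has basis the elementary matrices $e_{ij}$ ($i,j\in\hat I$) of parity $|i|+|j|$, with supercommutator bracket; $\mathfrak{gl}(m|n)$ is the subalgebra spanned by $e_{ij}$, $i,j\in I$. Cartan subalgebras $\mathfrak{h}_{m+1|n},\mathfrak{h}_{m|n}$ are the diagonal matrices; highest weights are with respect to upper triangular matrices; a weight $\lambda$ is the tuple of values $\lambda_i=\lambda(e_{ii})$, and $(\delta_i)$ is the basis dual to $(e_{ii})$, with form $(\delta_i,\delta_j)=(-1)^{|i||j|}\delta_{ij}$.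 $\rho_{m|n}=(m,\dots,1,-1,\dots,-n)$, $\rho_{m+1|n}=(m+1,m,\dots,1,-1,\dots,-n)$. $\mathcal{F}=\mathbb{C}[t_0^{\pm1},t_1,\dots,t_m]\otimes\Lambda_n$ with $\Lambda_n$ the exterior algebra on odd generators $t_{\bar 1},\dots,t_{\bar n}$ (supercommutative); $\partial_i=\partial/\partial t_i$ is the left superderivative. $\mathcal{D}'(m|n)$ is the superalgebra of operators on $\mathcal{F}$ generated by left multiplications by $t_i/t_0$ and by $t_0\partial_i$, $i\in\hat I$. $\mathcal{E}=\sum_{i\in\hat I}t_i\partial_i$. The center of $\mathcal{D}'(m|n)\otimes U(\mathfrak{gl}(m|n))$ is $\mathbb{C}[\mathcal{E}]\otimes Z(U(\mathfrak{gl}(m|n)))$. Tensor products use the usual sign rule. For such central $R$, $\varphi_R:U(\mathfrak{gl}(m+1|n))\to\mathcal{D}'(m|n)\otimes U(\mathfrak{gl}(m|n))$ is the superalgebra homomorphism with $e_{ab}\mapsto t_a\partial_b\otimes1+1\otimes e_{ab}+\delta_{ab}(-1)^{|a||b|}R$, $e_{a0}\mapsto t_a\partial_0\otimes1-\sum_{j\in I}(-1)^{|a||j|}\frac{t_j}{t_0}\otimes e_{aj}$, $e_{0b}\mapsto t_0\partial_b\otimes1$, $e_{00}\mapsto t_0\partial_0\otimes1+R$ for $a,b\in I$. Harish-Chandra maps: $\chi_{m|n}:Z(U(\mathfrak{gl}(m|n)))\to\mathbb{C}[\ell_1,\dots,\ell_m,\ell_{\bar1},\dots,\ell_{\bar n}]$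 is the homomorphism such that every central $z$ acts on the simple module $L(\lambda)$ of highest weight $\lambda$ as the scalar obtained by evaluating $\chi_{m|n}(z)$ at $\ell=\lambda+\rho_{m|n}$. $\chi_{m+1|n}:Z(U(\mathfrak{gl}(m+1|n)))\to\mathbb{C}[\ell_0,\ell_1,\dots,\ell_{\bar n}]$ is defined likewise with $\rho_{m+1|n}$. Let $I(\mathfrak{h}_{m|n})$ be the algebra of polynomial functions $\theta$ on $\mathfrak{h}_{m|n}^*$ (polynomials in the coordinates $\ell_i$, $i\in I$) that are invariant under $S_m\times S_n$ (permuting unbarred and barred coordinates separately) and satisfy $\theta(\lambda)=\theta(\lambda+t\alpha)$ for all $t\in\mathbb{C}$ whenever $\alpha$ is an odd root $\pm(\delta_i-\delta_{\bar j})$ and $(\lambda,\alpha)=0$; define $I(\mathfrak{h}_{m+1|n})$ likewise with index set $\hat I$. It is known that $\chi_{m|n}$ and $\chi_{m+1|n}$ are isomorphisms onto $I(\mathfrak{h}_{m|n})$ and $I(\mathfrak{h}_{m+1|n})$. Define the isomorphism $\chi_{0,m|n}:\mathbb{C}[\mathcal{E}]\otimes Z(U(\mathfrak{gl}(m|n)))\to\mathbb{C}[\ell_0]\otimes I(\mathfrak{h}_{m|n})$ by $\sum_i\mathcal{E}^i\otimes z_i\mapsto\sum_i\ell_0^i\otimes\chi_{m|n}(z_i)$. Put $\ell=\chi_{0,m|n}(R)$ and define $\tau:I(\mathfrak{h}_{m+1|n})\to\mathbb{C}[\ell_0]\otimes I(\mathfrak{h}_{m|n})$ by $$\tau(p(\ell_0,\dots,\ell_m,\ell_{\bar1},\dots,\ell_{\bar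 n}))=p(\ell_0+\ell+m+1,\ \ell_1+\ell,\dots,\ell_m+\ell,\ \ell_{\bar1}-\ell,\dots,\ell_{\bar n}-\ell).$$ *)

(* Defs.v *)
From HB Require Import structures.
From mathcomp Require Import all_boot all_order all_algebra all_fingroup.
From mathcomp Require Import boolp.
From mathcomp Require Import freeg mpoly.

Set Implicit Arguments.
Unset Strict Implicit.
Unset Printing Implicit Defensive.

Import GRing.Theory.
Local Open Scope ring_scope.

(* Conventions.  The index set {1,..,m, \bar 1,..,\bar n} is 'I_(m + n) with its
   natural order: i is unbarred iff i < m.  The extended index set
   {0} u I is 'I_(m.+1 + n), with 0 = ord0 and i in I embedded as fintype.lift ord0 i.
   Thus every object attached to gl(m+1|n) is the one attached to gl(m|n),
   taken at m.+1.  Parities are booleans, added with (+). *)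

Definition par (m n : nat) (i : 'I_(m + n)) : bool := (m <= i)%N.

Definition zero_idx (m n : nat) : 'I_(m.+1 + n) := @ord0 (m + n).
Definition up (m n : nat) (i : 'I_(m + n)) : 'I_(m.+1 + n) :=
  fintype.lift ord0 i.

Section LinearAndSuper.
Variable C : fieldType.

Definition bilinear_map (V W X : lmodType C) (f : V -> W -> X) : Prop :=
  (forall w, linear (f^~ w)) /\ (forall v, linear (f v)).

(* [h b v] reads: v is homogeneous of parity b. *)
Definition is_grading (V : lmodType C) (h : bool -> V -> Prop) : Prop :=
  [/\ forall b, h b 0,
      forall b a u v, h b u -> h b v -> h b (a *: u + v),
      forall v, exists v0 v1, [/\ h false v0, h true v1 & v = v0 + v1]
    & forall v, h false v -> h true v -> v = 0].

Inductive generated (A : algType C) (S : A -> Prop) : A -> Prop :=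
| gen_base x : S x -> generated S x
| gen_one : generated S 1
| gen_lin a x y : generated S x -> generated S y -> generated S (a *: x + y)
| gen_mul x y : generated S x -> generated S y -> generated S (x * y).

(* In the enveloping algebra of gl(m|n) the elements commuting with e_ii for all
   i have weight 0, hence are even, so this is also the supercenter. *)
Definition central (A : algType C) (z : A) : Prop := forall x, z * x = x * z.

Definition is_subalgebra (A : algType C) (S : A -> Prop) : Prop :=
  [/\ S 1, forall a x y, S x -> S y -> S (a *: x + y)
    & forall x y, S x -> S y -> S (x * y)].

(* T, with the pure tensors t a b, is the tensor product of the superalgebras
   A and B: it represents bilinear maps on A * B, and its product obeys the
   sign rule. *)
Definition is_super_tensor (A B : algType C)
    (hA : bool -> A -> Prop) (hB : bool -> B -> Prop)
    (T : algType C) (t : A -> B -> T) : Prop :=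
  [/\ bilinear_map t,
      t 1 1 = 1,
      forall p q a b c d, hB p b -> hA q c ->
        t a b * t c d = (-1) ^+ (p && q) *: t (a * c) (b * d)
    & forall (W : lmodType C) (f : A -> B -> W), bilinear_map f ->
        exists2 g : {linear T -> W}, (forall a b, g (t a b) = f a b)
          & forall g' : {linear T -> W},
              (forall a b, g' (t a b) = f a b) -> g' =1 g].

End LinearAndSuper.

Section Gl.
Variables (C : fieldType) (m n : nat).
Local Notation I := 'I_(m + n).
Local Notation gl := 'M[C]_(m + n).

(* gl is gl(m|n); delta_mx i j is the elementary matrix e_ij. *)
Definition gl_homog (b : bool) (x : gl) : Prop :=
  forall i j, x i j != 0 -> par i (+) par j = b.

(* f sends the supercommutator of gl(m|n) to the supercommutator of A. *)
Definition super_rep (A : algType C) (f : gl -> A) : Prop :=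
  forall b c x y, gl_homog b x -> gl_homog c y ->
    f (x *m y - (-1) ^+ (b && c) *: (y *m x))
      = f x * f y - (-1) ^+ (b && c) *: (f y * f x).

(* (U, iota) is the universal enveloping algebra of gl(m|n). *)
Definition is_enveloping (U : algType C) (iota : {linear gl -> U}) : Prop :=
  super_rep iota /\
  forall (A : algType C) (f : {linear gl -> A}), super_rep f ->
    exists2 g : {lrmorphism U -> A}, (forall x, g (iota x) = f x)
      & forall g' : {lrmorphism U -> A}, (forall x, g' (iota x) = f x) ->
          g' =1 g.

Section Enveloping.
Variables (U : algType C) (iota : {linear gl -> U}).

Inductive env_homog : bool -> U -> Prop :=
| eh_gl b x : gl_homog b x -> env_homog b (iota x)
| eh_one : env_homog false 1
| eh_lin b a x y :
    env_homog b x -> env_homog b y -> env_homog b (a *: x + y)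
| eh_mul b c x y :
    env_homog b x -> env_homog c y -> env_homog (b (+) c) (x * y).

Definition is_supermodule (V : lmodType C) (h : bool -> V -> Prop)
    (act : U -> V -> V) : Prop :=
  [/\ is_grading h, bilinear_map act,
      (forall v, act 1 v = v) /\
        (forall x y v, act (x * y) v = act x (act y v))
    & forall b c x v, env_homog b x -> h c v -> h (b (+) c) (act x v)].

Definition is_subsupermodule (V : lmodType C) (h : bool -> V -> Prop)
    (act : U -> V -> V) (W : V -> Prop) : Prop :=
  [/\ W 0, forall a u v, W u -> W v -> W (a *: u + v),
      forall x v, W v -> W (act x v)
    & forall v0 v1, h false v0 -> h true v1 -> W (v0 + v1) -> W v0 /\ W v1].

Definition is_simple (V : lmodType C) (h : bool -> V -> Prop)
    (act : U -> V -> V) : Prop :=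
  (exists v : V, v != 0) /\
  forall W, is_subsupermodule h act W ->
    (forall v, W v -> v = 0) \/ (forall v, W v).

(* A weight is the tuple of its values lambda_i = lambda (e_ii). *)
Definition is_highest_weight_vector (V : lmodType C) (h : bool -> V -> Prop)
    (act : U -> V -> V) (lam : I -> C) (v : V) : Prop :=
  [/\ v != 0, exists b, h b v,
      forall i j : I, (i < j)%N -> act (iota (delta_mx i j)) v = 0
    & forall i : I, act (iota (delta_mx i i)) v = lam i *: v].

Definition rho (i : I) : C :=
  if par i then - (i - m).+1%:R else (m - i)%:R.

(* The simple module with a highest weight vector of weight lam is L(lam). *)
Definition is_harish_chandra (chi : U -> {mpoly C[m + n]}) : Prop :=
  [/\ chi 1 = 1,
      forall a x y, central x -> central y ->
        chi (a *: x + y) = a *: chi x + chi y,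
      forall x y, central x -> central y -> chi (x * y) = chi x * chi y
    & forall (V : lmodType C) (h : bool -> V -> Prop) (act : U -> V -> V)
        (lam : I -> C) (v : V),
        is_supermodule h act -> is_simple h act ->
        is_highest_weight_vector h act lam v ->
        forall z, central z -> forall w,
          act z w = (chi z).@[fun i => lam i + rho i] *: w].

End Enveloping.

Definition wform (lam mu : I -> C) : C :=
  \sum_i (-1) ^+ par i * (lam i * mu i).

Definition odd_root (al : I -> C) : Prop :=
  exists (i j : I) (s : bool), [/\ ~~ par i, par j
    & forall k, al k = (-1) ^+ s * ((k == i)%:R - (k == j)%:R)].

(* Membership in I(h_{m|n}); 'X_i is the coordinate l_i. *)
Definition in_Ih (p : {mpoly C[m + n]}) : Prop :=
  (forall s : 'S_(m + n), (forall i, par (s i) = par i) -> msym s p = p) /\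
  (forall al lam : I -> C, odd_root al -> wform lam al = 0 ->
     forall c : C, p.@[fun i => lam i + c * al i] = p.@[lam]).

Definition is_iso_onto_Ih (U : algType C) (chi : U -> {mpoly C[m + n]}) :
    Prop :=
  [/\ forall z, central z -> in_Ih (chi z),
      forall x y, central x -> central y -> chi x = chi y -> x = y
    & forall p, in_Ih p -> exists2 z, central z & chi z = p].

End Gl.

Section Fock.
Variables (C : fieldType) (m n : nat).

(* ((k, a), S) encodes t_0^k t_1^(a_1) ... t_m^(a_m) t_S, where t_S is the
   product of the odd t_j, j in S, in increasing order. *)
Definition mon : Type := (int * {ffun 'I_m -> nat} * {set 'I_n})%type.
HB.instance Definition _ := Choice.on mon.

Definition fockT : Type := {freeg mon / C}.
HB.instance Definition _ := GRing.Lmodule.on fockT.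

Definition bas (x : mon) : fockT := << x >>.

Definition linext (f : mon -> fockT) : fockT -> fockT := fglift f.

(* t_S t_S' = (-1)^inversions t_(S u S') if S, S' are disjoint, else 0. *)
Definition inversions (S S' : {set 'I_n}) : nat :=
  #|[set p in setX S S' | (p.2 < p.1)%N]|.

Definition mon_mul (x y : mon) : fockT :=
  if [disjoint x.2 & y.2] then
    (-1) ^+ inversions x.2 y.2 *:
      bas (x.1.1 + y.1.1, [ffun i => (x.1.2 i + y.1.2 i)%N], x.2 :|: y.2)
  else 0.

Definition t0pow (k : int) : mon := (k, [ffun => 0%N], set0).

(* The monomial t_i t_0^k. *)
Definition t_t0pow (i : 'I_(m.+1 + n)) (k : int) : mon :=
  match split i with
  | inl i' => if unlift ord0 i' is Some a
              then (k, [ffun b => (b == a : nat)], set0)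
              else (1 + k, [ffun => 0%N], set0)
  | inr j => (k, [ffun => 0%N], [set j])
  end.

Definition mon_deriv (i : 'I_(m.+1 + n)) (x : mon) : fockT :=
  match split i with
  | inl i' =>
      if unlift ord0 i' is Some a
      then (x.1.2 a)%:R *: bas (x.1.1, [ffun b => (x.1.2 b - (b == a))%N], x.2)
      else x.1.1%:~R *: bas (x.1.1 - 1, x.1.2, x.2)
  | inr j =>
      if j \in x.2
      then (-1) ^+ #|[set s in x.2 | (s < j)%N]| *: bas (x.1, x.2 :\ j)
      else 0
  end.

Lemma linext_linear f : linear (linext f).
Proof.
have add u v : linext f (u + v) = linext f u + linext f v.
  have B := lift_is_additive f.
  have f0 : fglift f 0 = 0 by have := B 0 0; rewrite !subrr.
  have fN w : fglift f (- w) = - fglift f w.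
    by have := B 0 w; rewrite f0 !sub0r.
  by have := B u (- v); rewrite fN !opprK.
move=> a u v; rewrite add; congr (_ + _).
have f0 : linext f 0 = 0 by apply: (addrI (linext f 0)); rewrite -add !addr0.
move: u; apply: freeg_ind_dom0 => [|k x X _ _ IH].
  by rewrite scaler0 f0 scaler0.
rewrite scalerDr !add IH scalerDr; congr (_ + _).
have -> : a *: << k *g x >> = << (a * k) *g x >> :> {freeg mon / C}.
  by apply/eqP/freeg_eqP => y; rewrite coeffZ !coeffU mulrA.
by rewrite /linext !liftU scalerA.
Qed.

Lemma linext_bas f x : linext f (bas x) = f x.
Proof. by rewrite /linext liftU scale1r. Qed.

Lemma lin_bas_ext (f g : fockT -> fockT) : linear f -> linear g ->
  (forall x, f (bas x) = g (bas x)) -> f =1 g.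
Proof.
move=> lf lg fg.
have f0 : f 0 = 0.
  by have := lf (-1) 0 0; rewrite scaler0 addr0 scaleN1r addNr.
have g0 : g 0 = 0.
  by have := lg (-1) 0 0; rewrite scaler0 addr0 scaleN1r addNr.
apply: freeg_ind_dom0 => [|k x X _ _ IH]; first by rewrite f0 g0.
have -> : << k *g x >> = k *: bas x.
  by apply/eqP/freeg_eqP => y; rewrite coeffZ !coeffU mul1r.
by rewrite lf lg fg IH.
Qed.

Record endF : Type := EndF { efun :> fockT -> fockT; efunP : linear efun }.

HB.instance Definition _ := gen_eqMixin endF.
HB.instance Definition _ := gen_choiceMixin endF.

Lemma endF_ext (f g : endF) : f =1 g -> f = g.
Proof.
case: f g => [f lf] [g lg] /= /funext fg; rewrite fg in lf *.
by congr EndF; apply: Prop_irrelevance.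
Qed.

Definition end0 : endF.
Proof. by exists (fun=> 0) => a u v; rewrite scaler0 addr0. Defined.
Definition endD (f g : endF) : endF.
Proof.
by exists (fun u => f u + g u) => a u v; rewrite !efunP scalerDr addrACA.
Defined.
Definition endN (f : endF) : endF.
Proof. by exists (fun u => - f u) => a u v; rewrite efunP opprD scalerN. Defined.
Definition end1 : endF.
Proof. by exists id. Defined.
Definition endM (f g : endF) : endF.
Proof. by exists (f \o g) => a u v; rewrite /= !efunP. Defined.
Definition endZ (a : C) (f : endF) : endF.
Proof.
exists (fun u => a *: f u) => b u v.
by rewrite efunP scalerDr !scalerA mulrC.
Defined.

Fact endDA : associative endD.
Proof. by move=> f g h; apply: endF_ext => u /=; rewrite addrA. Qed.
Fact endDC : commutative endD.
Proof. by move=> f g; apply: endF_ext => u /=; rewrite addrC. Qed.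
Fact end0D : left_id end0 endD.
Proof. by move=> f; apply: endF_ext => u /=; rewrite add0r. Qed.
Fact endND : left_inverse end0 endN endD.
Proof. by move=> f; apply: endF_ext => u /=; rewrite addNr. Qed.
HB.instance Definition _ := GRing.isZmodule.Build endF endDA endDC end0D endND.

Fact endMA : associative endM.
Proof. by move=> f g h; apply: endF_ext. Qed.
Fact end1M : left_id end1 endM.
Proof. by move=> f; apply: endF_ext. Qed.
Fact endM1 : right_id end1 endM.
Proof. by move=> f; apply: endF_ext. Qed.
Fact endMDl : left_distributive endM endD.
Proof. by move=> f g h; apply: endF_ext. Qed.
Fact endMDr : right_distributive endM endD.
Proof.
move=> f g h; apply: endF_ext => u /=.
by rewrite -[g u]scale1r efunP !scale1r.
Qed.
Fact end1_neq0 : end1 != 0.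
Proof.
apply/eqP => /(congr1 (fun f : endF => f (bas (t0pow 0)))) /=.
move=> /(congr1 (coeff (t0pow 0))) /eqP.
by rewrite coeffU coeff0 eqxx mulr1 oner_eq0.
Qed.
HB.instance Definition _ := GRing.Zmodule_isNzRing.Build endF
  endMA end1M endM1 endMDl endMDr end1_neq0.

Fact endZA a b f : endZ a (endZ b f) = endZ (a * b) f.
Proof. by apply: endF_ext => u /=; rewrite scalerA. Qed.
Fact endZ1 : left_id 1 endZ.
Proof. by move=> f; apply: endF_ext => u /=; rewrite scale1r. Qed.
Fact endZDr : right_distributive endZ +%R.
Proof. by move=> a f g; apply: endF_ext => u /=; rewrite scalerDr. Qed.
Fact endZDl f : {morph endZ^~ f : a b / a + b}.
Proof. by move=> a b; apply: endF_ext => u /=; rewrite scalerDl. Qed.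
HB.instance Definition _ := GRing.Zmodule_isLmodule.Build C endF
  endZA endZ1 endZDr endZDl.

Fact endZAl (a : C) (f g : endF) : a *: (f * g) = (a *: f) * g.
Proof. exact: endF_ext. Qed.
HB.instance Definition _ := GRing.Lmodule_isLalgebra.Build C endF endZAl.
Fact endZAr (a : C) (f g : endF) : a *: (f * g) = f * (a *: g).
Proof.
apply: endF_ext => u /=.
have f0 : f 0 = 0 by have := efunP f (-1) 0 0; rewrite scaler0 addr0 scaleN1r addNr.
by have := efunP f a (g u) 0; rewrite f0 !addr0.
Qed.
HB.instance Definition _ := GRing.Lalgebra_isAlgebra.Build C endF endZAr.

Definition lmul (x : mon) : endF := EndF (linext_linear (mon_mul x)).
Definition pd (i : 'I_(m.+1 + n)) : endF := EndF (linext_linear (mon_deriv i)).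

Definition op_t (i : 'I_(m.+1 + n)) : endF := lmul (t_t0pow i 0).
Definition op_t_over_t0 (i : 'I_(m.+1 + n)) : endF := lmul (t_t0pow i (-1)).
Definition op_t0 : endF := op_t (zero_idx m n).

Definition Dgen (d : endF) : Prop :=
  exists i, d = op_t_over_t0 i \/ d = op_t0 * pd i.

Definition in_D : pred endF := [pred d | `[< generated Dgen d >]].

Fact in_D_subalg : GRing.subsemialg_closed in_D.
Proof.
have D0 : generated Dgen (0 : endF).
  have := gen_lin (-1) (gen_one Dgen) (gen_one Dgen).
  by rewrite scaleN1r addNr.
split; first by apply/asboolP; exact: gen_one.
- split; first exact/asboolP.
  move=> u v /asboolP Du /asboolP Dv; apply/asboolP.
  by rewrite -[u]scale1r; exact: gen_lin.
- move=> a u /asboolP Du; apply/asboolP.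
  by rewrite -[_ *: _]addr0; exact: gen_lin.
- by move=> u v /asboolP Du /asboolP Dv; apply/asboolP; exact: gen_mul.
Qed.

Record Dprime : Type := MkD { dop :> endF; dopP : in_D dop }.
HB.instance Definition _ := [isSub for dop].
HB.instance Definition _ := [Choice of Dprime by <:].
HB.instance Definition _ := GRing.SubChoice_isSubAlgebra.Build C endF in_D Dprime
  in_D_subalg.

Fact in_D_t_over_t0 i : in_D (op_t_over_t0 i).
Proof. by apply/asboolP/gen_base; exists i; left. Qed.

Fact in_D_t0_pd i : in_D (op_t0 * pd i).
Proof. by apply/asboolP/gen_base; exists i; right. Qed.

Lemma t_t0powE i (k : int) : t_t0pow i k =
  ((t_t0pow i 0).1.1 + k, (t_t0pow i 0).1.2, (t_t0pow i 0).2).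
Proof.
rewrite /t_t0pow; case: (split i) => [i'|j] /=; last by rewrite add0r.
by case: (unlift _ _) => [a|] /=; rewrite ?add0r ?addr0.
Qed.

Lemma op_t0E : op_t0 = lmul (t0pow 1).
Proof.
congr lmul; rewrite /t_t0pow; case: splitP => [i' /= i'0|j] //=.
by have -> : i' = ord0 by [apply: val_inj]; rewrite unlift_none.
Qed.

Lemma op_t_over_t0_mul i : op_t_over_t0 i * op_t0 = op_t i.
Proof.
rewrite op_t0E; apply: endF_ext; apply: lin_bas_ext; try exact: efunP.
move=> [[k a] S] /=; rewrite !linext_bas.
have -> : mon_mul (t0pow 1) (k, a, S) = bas (1 + k, a, S).
  rewrite /mon_mul /= -setI_eq0 set0I eqxx set0U.
  have -> : inversions set0 S = 0%N.
    by apply/eqP; rewrite cards_eq0; apply/eqP/setP => p; rewrite !inE.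
  by rewrite scale1r; congr (bas (_, _, _)); apply/ffunP => j; rewrite !ffunE.
rewrite linext_bas t_t0powE /mon_mul /=; case: ifP => // _.
by congr (_ *: bas (_, _, _)); rewrite -addrA addKr.
Qed.

Fact in_D_t_pd i j : in_D (op_t i * pd j).
Proof.
rewrite -op_t_over_t0_mul -mulrA; apply/asboolP/gen_mul.
  by apply/asboolP; exact: in_D_t_over_t0.
by apply/asboolP; exact: in_D_t0_pd.
Qed.

(* The operators t_i / t_0, t_0 d_i and t_i d_j = (t_i / t_0) (t_0 d_j). *)
Definition D_t i : Dprime := MkD (in_D_t_over_t0 i).
Definition D_p i : Dprime := MkD (in_D_t0_pd i).
Definition D_tp i j : Dprime := MkD (in_D_t_pd i j).
Definition Euler : Dprime := \sum_i D_tp i i.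

Definition F_homog (b : bool) (f : fockT) : Prop :=
  forall x : mon, coeff x f != 0 -> odd #|x.2| = b.

Definition D_homog (b : bool) (d : Dprime) : Prop :=
  forall c f, F_homog c f -> F_homog (b (+) c) (d f).

End Fock.

Section Phi.
Variables (C : fieldType) (m n : nat).
Variables (U : algType C) (iota : {linear 'M[C]_(m + n) -> U}).
Variables (T : algType C) (t : Dprime C m n -> U -> T).

Local Notation "x ⊗ y" := (t x y) (at level 40).
Local Notation e i j := (iota (delta_mx i j)).
Local Notation "0'" := (zero_idx m n) (at level 0).

Definition E_sum (N : nat) (z : nat -> U) : T :=
  \sum_(i < N) (Euler C m n ^+ i) ⊗ (z i).

Definition in_CE_Z (w : T) : Prop :=
  exists N z, (forall i, central (z i)) /\ w = E_sum N z.

Definition is_phi (R : T) (U' : algType C)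
    (iota' : {linear 'M[C]_(m.+1 + n) -> U'}) (phi : {lrmorphism U' -> T}) :
    Prop :=
  [/\ forall a b : 'I_(m + n),
        phi (iota' (delta_mx (up a) (up b)))
          = D_tp C (up a) (up b) ⊗ 1 + 1 ⊗ e a b
            + ((a == b)%:R * (-1) ^+ (par a && par b)) *: R,
      forall a : 'I_(m + n),
        phi (iota' (delta_mx (up a) 0'))
          = D_tp C (up a) 0' ⊗ 1
            - \sum_j (-1) ^+ (par a && par j) *: (D_t C (up j) ⊗ e a j),
      forall b : 'I_(m + n),
        phi (iota' (delta_mx 0' (up b))) = D_p C (up b) ⊗ 1
    & phi (iota' (delta_mx 0' 0')) = D_p C 0' ⊗ 1 + R].

Section Chi0.
Variables (chi : U -> {mpoly C[m + n]}).

(* C[l_0] ⊗ I(h_{m|n}), as polynomials in 'X = l_0 over C[l_i, i in I] *)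
Definition in_Cl0_Ih (f : {poly {mpoly C[m + n]}}) : Prop :=
  forall i, in_Ih f`_i.

(* chi0 is chi_{0,m|n}; its values off C[E] ⊗ Z(U) are irrelevant. *)
Definition is_chi0 (chi0 : T -> {poly {mpoly C[m + n]}}) : Prop :=
  forall N z, (forall i, central (z i)) ->
    chi0 (E_sum N z) = \sum_(i < N) 'X^i * (chi (z i))%:P.

Definition is_inverse_chi0 (chi0 : T -> {poly {mpoly C[m + n]}})
    (chi0inv : {poly {mpoly C[m + n]}} -> T) : Prop :=
  [/\ forall w, in_CE_Z w -> chi0inv (chi0 w) = w,
      forall f, in_Cl0_Ih f -> in_CE_Z (chi0inv f)
    & forall f, in_Cl0_Ih f -> chi0 (chi0inv f) = f].

End Chi0.
End Phi.

(* The substitution l_0 |-> l_0 + l + m + 1, l_i |-> l_i + l (i unbarred),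
   l_i |-> l_i - l (i barred). *)
Definition tau (C : fieldType) (m n : nat) (l : {poly {mpoly C[m + n]}})
    (p : {mpoly C[m.+1 + n]}) : {poly {mpoly C[m + n]}} :=
  mmap (fun c : C => (c%:MP)%:P)
    (fun k : 'I_(m.+1 + n) =>
       if unlift ord0 k is Some i
       then ('X_(i : 'I_(m + n)))%:P + (-1) ^+ par (i : 'I_(m + n)) * l
       else 'X + l + m.+1%:R) p.

(* Main.v *)
(* A linear functional c with c (x e_ij) = 0 for i < j, c (e_ij x) = 0 for i > j and
   weight lam under the Cartan subalgebra on both sides is a coefficient of a highest
   weight vector; c (y z) = chi(z)(lam + rho) c (y) for central z, because the matrix
   coefficients y |-> c (y x) form the simple module L(lam).  If c is such a functional
   for gl(m|n), then composing phi with d |-> (coefficient of t_0^u in d t_0^u) on D' and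
   with c on U gives one for gl(m+1|n): t_0^u ⊗ v_lam is a highest weight vector, of
   weight u + r at 0, lam_i + r at unbarred i and lam_j - r at barred j, where r is the
   value of R.  This is the substitution tau.

   It remains to know that phi(z) lies in C[E] ⊗ Z(U).  It commutes with the images of
   e_0b and e_00, hence with the derivations t_0 d_b; such an element of D' ⊗ U is
   determined by its action on the powers t_0^u, which is polynomial in u, and its
   coefficients are central because phi(z) commutes with the images of the e_ab.

   Equality of polynomials then follows by evaluation at the points (u, lam + rho) for
   which a functional c exists.  Enough lam come from a Fock space of bosons and fermions
   with many copies of the natural module, whose highest weight vectors are products of
   fermions. *)
From HB Require Import structures.
From mathcomp Require Import functions.
Require Import Defs.
From mathcomp Require Import all_boot all_order all_algebra.
From mathcomp Require Import boolp reals complex freeg mpoly zify ring.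

Set Implicit Arguments.
Unset Strict Implicit.
Unset Printing Implicit Defensive.

Import GRing.Theory Num.Theory.
Local Open Scope ring_scope.

(** The algebras [U], [U'] and [T] are known only through their universal properties, so no monomial
    basis and no Verma module is at hand: a highest weight functional has to be exhibited before its
    weight can serve as an evaluation point. This is what the Fock space is for. Its weights are
    integral and satisfy inequalities, but they are Zariski dense, which suffices.

    Functionals replace modules because $t_0^u \otimes v_\lambda$ need not generate a simple module.
    The conditions on the left side of a functional amount to passing to the simple quotient, so
    neither the generated submodule nor its maximal submodule has to be found. Simplicity is proved
    once, for the space of matrix coefficients of an arbitrary functional.

    The Harish-Chandra maps are specified on supermodules only, so parities must be controlled.
    Parity is read off from weights: the commutator with the sum of the odd diagonal matrices has
    even eigenvalues on even elements and odd ones on odd elements. This gives the grading of the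
    module of coefficients and the evenness of central elements. *)

(** * Subspaces and subalgebras cut out by predicates *)

Section SubLmodule.
Variables (C : fieldType) (V : lmodType C) (S : V -> Prop).

Definition submodule : Prop := S 0 /\ forall a x y, S x -> S y -> S (a *: x + y).

(** The carrier does not mention the closure proof; it is an argument of the type so that the module
    structure, which depends on it, can be attached to the type. *)
Definition sub_lmod of submodule := {x : V | `[< S x >]}.

Variable clS : submodule.
Local Notation subV := (sub_lmod clS).

HB.instance Definition _ := SubChoice.on subV.

Fact sub_lmod_closed : GRing.submod_closed [pred x | `[< S x >]].
Proof.
case: clS => S0 Slin; split; first exact/asboolP.
by move=> a x y /asboolP Sx /asboolP Sy; apply/asboolP; exact: Slin.
Qed.
HB.instance Definition _ :=
  GRing.SubChoice_isSubLmodule.Build C V _ subV sub_lmod_closed.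

Lemma sub_lmodP (x : subV) : S (val x).
Proof. exact: (asboolP _ (valP x)). Qed.

Definition in_sub_lmod x (Sx : S x) : subV := exist _ x (asboolT Sx).
End SubLmodule.

Section SubAlgebra.
Variables (C : fieldType) (A : algType C) (S : A -> Prop).

Definition sub_alg of is_subalgebra S := {x : A | `[< S x >]}.

Variable clS : is_subalgebra S.
Local Notation subA := (sub_alg clS).

HB.instance Definition _ := SubChoice.on subA.

Fact sub_alg_closed : GRing.subalg_closed [pred x | `[< S x >]].
Proof.
case: clS => S1 Slin Smul; split; first exact/asboolP.
- by move=> a x y /asboolP Sx /asboolP Sy; apply/asboolP; exact: Slin.
- by move=> x y /asboolP Sx /asboolP Sy; apply/asboolP; exact: Smul.
Qed.
HB.instance Definition _ :=
  GRing.SubChoice_isSubAlgebra.Build C A _ subA (GRing.subalg_closed_semi sub_alg_closed).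

Lemma sub_algP (x : subA) : S (val x).
Proof. exact: (asboolP _ (valP x)). Qed.

Definition sub_alg_val : subA -> A := \val.
HB.instance Definition _ := GRing.RMorphism.copy sub_alg_val (\val : subA -> A).
Fact sub_alg_val_scalable : scalable sub_alg_val.
Proof. by []. Qed.
HB.instance Definition _ := GRing.isScalable.Build C subA A *:%R sub_alg_val
  sub_alg_val_scalable.

Definition in_sub_alg x (Sx : S x) : subA := exist _ x (asboolT Sx).
End SubAlgebra.


(** * Sums of eigenvectors of a linear operator *)

Section Eigenspan.
Variables (C : fieldType) (V : lmodType C) (A : {linear V -> V}).

Inductive eig_span (K : C -> Prop) : V -> Prop :=
| eig_vec k x : K k -> A x = k *: x -> eig_span K x
| eig_lin a x y : eig_span K x -> eig_span K y -> eig_span K (a *: x + y).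

Let shift (k : C) (x : V) := A x - k *: x.
Let shifts (s : seq C) (x : V) := foldr shift x s.

Let shifts_lin s a x y : shifts s (a *: x + y) = a *: shifts s x + shifts s y.
Proof.
elim: s => //= k s ->; rewrite /shift linearP !scalerDr !scalerN.
by rewrite opprD [k *: (a *: _)]scalerA mulrC -scalerA addrACA.
Qed.

Let shifts_shift s k x : shifts s (shift k x) = shift k (shifts s x).
Proof.
elim: s => //= j s ->; rewrite /shift !linearB !linearZ /= !scalerA [j * k]mulrC.

by rewrite !addrA; congr (_ + _); rewrite addrAC.
Qed.

Let shifts_eig s k x : A x = k *: x ->
  shifts s x = (\prod_(j <- s) (k - j)) *: x.
Proof.
move=> Ax; elim: s => [|j s IH] /=; first by rewrite big_nil scale1r.
rewrite IH /shift linearZ /= Ax big_cons !scalerA -scalerBl; congr (_ *: _).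
by rewrite mulrBl mulrC [k * _]mulrC.
Qed.

(* The product of the [A - k] over the eigenvalues of [g] kills [g] and sends [v] to a
   nonzero multiple. *)
Lemma eig_span_absorb (K : C -> Prop) (W : V -> Prop) v g :
  submodule W -> (forall x, W x -> W (A x)) -> ~ K 0 ->
  A v = 0 -> eig_span K g -> W (v + g) -> W v.
Proof.
move=> [W0 Wlin] WA K0 Av Kg Wvg.
have [s [s0 sg]] : exists s, 0 \notin s /\ shifts s g = 0.
  elim: {Wvg} Kg => [k x Kk Ax|a x y _ [s [s0 sx]] _ [r [r0 ry]]].
    exists [:: k]; split; first by rewrite inE; apply/eqP => k0; case: K0; rewrite k0.
    by rewrite (shifts_eig _ Ax) big_seq1 subrr scale0r.
  exists (s ++ r); split; first by rewrite mem_cat negb_or s0.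
  rewrite shifts_lin {2}/shifts foldr_cat -/(shifts r y) ry.
  have sz t : shifts t 0 = 0.
    by elim: t => //= k t ->; rewrite /shift linear0 scaler0 subr0.
  rewrite -/(shifts s 0) sz addr0.
  have -> : shifts (s ++ r) x = shifts r (shifts s x).
    elim: s {s0 sx} => //= k s IH.
    by rewrite shifts_shift IH.
  by rewrite sx sz scaler0.
have Ws x : W x -> W (shifts s x).
  move=> Wx; elim: s {s0 sg} => //= k s IH.
  by rewrite /shift addrC -scaleNr; apply: Wlin => //; exact: WA.
move: (Ws _ Wvg); rewrite -[v]scale1r shifts_lin sg addr0 scale1r.
have Av0 : A v = 0 *: v by rewrite scale0r.
rewrite (shifts_eig _ Av0) => Wc.
set c := \prod_(j <- s) _ in Wc.
have c0 : c != 0.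
  rewrite /c prodf_seq_neq0; apply/allP => j js /=.
  by rewrite sub0r oppr_eq0; apply: contraNneq s0 => <-.
have := Wlin c^-1 _ _ Wc W0.
by rewrite addr0 scalerA mulVf.
Qed.

(** Absorption into the zero submodule, applied to $-g + g = 0$. *)
Lemma eig_span_ker (K : C -> Prop) g : ~ K 0 -> eig_span K g -> A g = 0 -> g = 0.
Proof.
move=> K0 Kg Ag; apply: oppr_inj; rewrite oppr0.
apply: (@eig_span_absorb K (fun x => x = 0) _ g) => //.
- by split=> // a x y -> ->; rewrite scaler0 addr0.
- by move=> x ->; rewrite linear0.
- by rewrite linearN Ag oppr0.
- by rewrite addNr.
Qed.
End Eigenspan.

(** * The enveloping algebra: generators, parity, evenness of the center *)

Section Enveloping.
Variables (C : numFieldType) (m n : nat).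
Variables (U : algType C) (iota : {linear 'M[C]_(m + n) -> U}).
Hypothesis U_env : is_enveloping iota.
Local Notation e i j := (iota (delta_mx i j)).
Local Notation hom := (env_homog iota).

Lemma iota_sum a : iota a = \sum_i \sum_j a i j *: e i j.
Proof.
rewrite {1}[a]matrix_sum_delta linear_sum; apply: eq_bigr => i _.
by rewrite linear_sum; apply: eq_bigr => j _; rewrite linearZ.
Qed.

Lemma gl_homog_delta i j : gl_homog (par i (+) par j) (delta_mx i j : 'M[C]_(m + n)).
Proof.
move=> k l; rewrite mxE.
have [->|_] := eqVneq k i; last by rewrite eqxx.
by have [->|_] := eqVneq l j; rewrite ?eqxx.
Qed.

Lemma homog_e i j : hom (par i (+) par j) (e i j).
Proof. by apply: eh_gl; exact: gl_homog_delta. Qed.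

Lemma homog0 b : hom b 0.
Proof. by rewrite -(linear0 iota); apply: eh_gl => i j; rewrite mxE eqxx. Qed.

Lemma homogD b x y : hom b x -> hom b y -> hom b (x + y).
Proof. by move=> hx hy; rewrite -[x]scale1r; exact: eh_lin. Qed.

Lemma homogZ b a x : hom b x -> hom b (a *: x).
Proof. by move=> hx; rewrite -[_ *: _]addr0; apply: eh_lin => //; exact: homog0. Qed.

(** The supercommutator relation solved for the product, a rule for reordering two generators. *)
Lemma env_bracket i j k l :
  e i j * e k l = (-1) ^+ ((par i (+) par j) && (par k (+) par l)) *: (e k l * e i j)
    + ((k == j)%:R *: e i l
       - (-1) ^+ ((par i (+) par j) && (par k (+) par l)) *: ((l == i)%:R *: e k j)).
Proof.
have := U_env.1 _ _ _ _ (@gl_homog_delta i j) (@gl_homog_delta k l).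
set s := (-1) ^+ _; rewrite !mul_delta_mx_cond linearB linearZ /=.
rewrite !linearMn /= => H.
rewrite [j == k]eq_sym in H.
by rewrite !scaler_nat -?scalerMnr -?mulNrn H addrCA subrr addr0.
Qed.

(** The universal property maps [U] to the subalgebra generated by the image of [iota]. Followed by
    the inclusion, this map fixes [iota], so by uniqueness it is the identity. *)
Lemma env_generated x : generated (fun y => exists a, y = iota a) x.
Proof.
set S := generated _.
have clS : is_subalgebra S.
  by split; [exact: gen_one|exact: gen_lin|exact: gen_mul].
have Si a : S (iota a) by apply: gen_base; exists a.
pose f a : sub_alg clS := in_sub_alg clS (Si a).
have f_lin : linear f by move=> a x1 y1; apply: val_inj; rewrite /= linearP.
pose fL := HB.pack_for {linear 'M[C]_(m + n) -> sub_alg clS} f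
  (GRing.isLinear.Build _ _ _ _ f f_lin).
have f_rep : super_rep fL.
  move=> b c x1 y1 hx hy; apply: val_inj => /=; exact: U_env.1.
have [g gf _] := U_env.2 _ fL f_rep.
pose vg : {lrmorphism U -> U} := @sub_alg_val _ _ _ clS \o g.
have [g0 _ g0u] := U_env.2 _ iota U_env.1.
have E : vg =1 idfun.
  move=> y; rewrite (g0u vg) => [|a]; last by rewrite /= gf.
  by rewrite (g0u idfun).
by rewrite -[x]E; exact: sub_algP.
Qed.

Lemma env_ind (P : U -> Prop) :
  P 1 -> (forall a x y, P x -> P y -> P (a *: x + y)) ->
  (forall i j x, P x -> P (e i j * x)) -> forall x, P x.
Proof.
move=> P1 Plin Pe x; rewrite -[x]mulr1.
have P0 : P 0 by have := Plin (-1) _ _ P1 P1; rewrite scaleN1r addNr.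
have Psum I (r : seq I) (F : I -> U) : (forall i, P (F i)) -> P (\sum_(i <- r) F i).
  move=> PF; elim: r => [|i r IH]; first by rewrite big_nil.
  by rewrite big_cons -[F i]scale1r; exact: Plin.
(* The factor 1 is generalized to any [u] with [P u]: for a product, the hypothesis for [y] feeds
   the one for [x]. *)
move: (env_generated x) 1 P1; elim=> {x} [x [a ->]||a x y _ IHx _ IHy|x y _ IHx _ IHy] u Pu.
- rewrite iota_sum mulr_suml; apply: (Psum) => i; rewrite mulr_suml.
  apply: (Psum) => j; rewrite -scalerAl -[_ *: _]addr0; apply: (Plin) => //.
  exact: Pe.
- by rewrite mul1r.
- by rewrite mulrDl -scalerAl; apply: Plin; [exact: IHx|exact: IHy].
- by rewrite -mulrA; apply: IHx; exact: IHy.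
Qed.

Lemma env_split x : exists x0 x1, [/\ hom false x0, hom true x1 & x = x0 + x1].
Proof.
elim/env_ind: x => [|a x y [x0 [x1 [h0 h1 ->]]] [y0 [y1 [k0 k1 ->]]]|i j x].
- by exists 1, 0; split; [exact: eh_one|exact: homog0|rewrite addr0].
- exists (a *: x0 + y0), (a *: x1 + y1); split; try exact: eh_lin.
  by rewrite scalerDr addrACA.
- move=> [x0 [x1 [h0 h1 ->]]]; have he := homog_e i j; rewrite mulrDr.
  move: (eh_mul he h0) (eh_mul he h1); case: (par i (+) par j) => /= k0 k1.
    by exists (e i j * x1), (e i j * x0); split=> //; rewrite addrC.
  by exists (e i j * x0), (e i j * x1); split.
Qed.

(** The parity automorphism. It acts by different signs on the two parities, which shows that they
    meet only in 0; the inductive definition of [env_homog] does not give this. *)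
Lemma env_sigma : exists sigma : {lrmorphism U -> U},
  forall b x, hom b x -> sigma x = (-1) ^+ b *: x.
Proof.
pose f (a : 'M[C]_(m + n)) := iota (\matrix_(i, j) ((-1) ^+ (par i (+) par j) * a i j)).
have f_lin : linear f.
  move=> a x y; rewrite /f -linearP; congr (iota _); apply/matrixP => i j.
  by rewrite !mxE mulrDr mulrCA.
pose fL := HB.pack_for {linear 'M[C]_(m + n) -> U} f
  (GRing.isLinear.Build _ _ _ _ f f_lin).
have fE b x : gl_homog b x -> f x = (-1) ^+ b *: iota x.
  move=> hx; rewrite /f -linearZ /=; congr (iota _); apply/matrixP => i j.
  rewrite !mxE; have [->|/hx ->] // := eqVneq (x i j) 0; by rewrite !mulr0.
have gl_mul b c (x y : 'M[C]_(m + n)) :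
    gl_homog b x -> gl_homog c y -> gl_homog (b (+) c) (x *m y).
  move=> hx hy i j; rewrite mxE => nz.
  have [k] : exists k, x i k * y k j != 0.
    apply/existsP; apply: contraNT nz; rewrite negb_exists => /forallP z.
    by apply/eqP; apply: big1 => k _; apply/eqP; have := z k; rewrite negbK.
  rewrite mulf_eq0 negb_or => /andP[/hx <- /hy <-].
  by rewrite -addbA [par k (+) _]addbA addbb.
have f_rep : super_rep fL.
  move=> b c x y hx hy; rewrite [fL _](fE (b (+) c)).
    rewrite [fL x](fE _ _ hx) [fL y](fE _ _ hy) (U_env.1 _ _ _ _ hx hy).
    rewrite -!scalerAl -!scalerAr !scalerA scalerBr scalerA -!signr_addb.
    by case: (b); case: (c).
  have hxy := gl_mul _ _ _ _ hx hy; have hyx := gl_mul _ _ _ _ hy hx.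
  move=> i j; rewrite !mxE.
  have [xy0|xyn _] := eqVneq ((x *m y) i j) 0; last by apply: hxy.
  have [yx0|yxn _] := eqVneq ((y *m x) i j) 0.
    by move: xy0 yx0; rewrite !mxE => -> ->; rewrite mulr0 subr0 eqxx.
  by rewrite [b (+) c]addbC; apply: hyx.
have [g gf _] := U_env.2 _ fL f_rep.
exists g => b x; elim=> {b x} [b x hx||b a x y _ gx _ gy|b c x y _ gx _ gy].
- by rewrite gf; exact: fE.
- by rewrite rmorph1 scale1r.
- by rewrite linearP /= gx gy scalerDr !scalerA mulrC.
- by rewrite rmorphM /= gx gy -scalerAl -scalerAr scalerA signr_addb.
Qed.

Lemma homog_disjoint x : hom false x -> hom true x -> x = 0.
Proof.
have [s sE] := env_sigma; move=> /sE s0 /sE; rewrite s0 !expr0 expr1 scale1r scaleN1r.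
move/eqP; rewrite -subr_eq0 opprK -mulr2n -scaler_nat scaler_eq0 pnatr_eq0 /=.
by move/eqP.
Qed.

(* The parity of a weight vector is the parity of its weight under the sum of the
   odd diagonal matrices. *)
Definition h_odd : U := \sum_(i | par i) e i i.

(** The ordinary commutator, also for odd [x]: it is applied to combinations [h] of diagonal
    matrices, which are even. *)
Definition ad (h x : U) := h * x - x * h.
Fact ad_linear h : linear (ad h).
Proof.
move=> a x y; rewrite /ad mulrDr mulrDl -scalerAr -scalerAl scalerBr.
by rewrite opprD addrACA.
Qed.
HB.instance Definition _ h := GRing.isLinear.Build C U U _ (ad h) (ad_linear h).

Lemma ad_mul h x y : ad h (x * y) = ad h x * y + x * ad h y.
Proof.
by rewrite /ad mulrBl mulrBr !mulrA addrA subrK.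
Qed.

Lemma ad_diag k i j : ad (e k k) (e i j) = ((i == k)%:R - (j == k)%:R) *: e i j.
Proof.
rewrite /ad env_bracket addbb /= !expr0 !scale1r addrC addrA addNr add0r.
rewrite scalerBl; congr (_ - _); first by case: eqP => [->|_]; rewrite ?scale0r.
by case: eqP => [->|_]; rewrite ?scale0r.
Qed.

Lemma ad_h_odd i j : ad h_odd (e i j) = ((par i)%:R - (par j)%:R) *: e i j.
Proof.
have -> : ad h_odd (e i j) = \sum_(k | par k) ad (e k k) (e i j).
  by rewrite /ad /h_odd mulr_suml mulr_sumr -sumrB.
rewrite (eq_bigr _ (fun k _ => ad_diag k i j)) -scaler_suml sumrB.
have E (l : 'I_(m + n)) : \sum_(k | par k) ((l == k)%:R : C) = (par l)%:R.
  rewrite big_mkcond (bigD1 l) //= eqxx big1 ?addr0 => [|k /negPf kl].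
    by case: par.
  by rewrite eq_sym kl; case: par.
by rewrite !E.
Qed.

Definition odd_eigenvalue b (k : C) : Prop := exists z : int, k = z%:~R /\ odd `|z|%N = b.

(** Each $e_{ij}$ has eigenvalue $|i| - |j|$, and eigenvalues add along products because [ad h_odd]
    is a derivation; parities of elements add in the same way. *)
Lemma homog_eig b x : hom b x ->
  eig_span (ad h_odd) (odd_eigenvalue b) x.
Proof.
have zero c : eig_span (ad h_odd) (odd_eigenvalue c) 0.
  by apply: (@eig_vec _ _ _ _ (c%:R)); [exists c; case: c|rewrite linear0 scaler0].
have clos c := @eig_lin _ _ (ad h_odd) (odd_eigenvalue c).
elim=> {b x} [b x hx||b a x y _ IHx _ IHy|b c x y _ IHx _ IHy].
- rewrite iota_sum pair_big /=; elim: (index_enum _) => [|[i j] r IH].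
    by rewrite big_nil.
  rewrite big_cons; have [->|nz] := eqVneq (x i j) 0.
    by rewrite scale0r add0r.
  apply: clos => //; apply: eig_vec (ad_h_odd i j).
  exists ((par i)%:Z - (par j)%:Z); rewrite rmorphB /=; split=> //.
  by rewrite -(hx _ _ nz); case: (par i); case: (par j).
- apply: (@eig_vec _ _ _ _ 0); first by exists 0.
  by rewrite /= /ad mulr1 mul1r subrr scale0r.
- exact: clos.
- elim: IHx => {x} [k x [z [-> zb]] kx|a x x' _ IH _ IH']; last first.
    by rewrite mulrDl -scalerAl; exact: clos.
  elim: IHy => {y} [l y [w [-> wc]] ly|a y y' _ IH _ IH']; last first.
    by rewrite mulrDr -scalerAr; exact: clos.
  apply: (@eig_vec _ _ _ _ (z + w)%:~R).
    exists (z + w); split=> //.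
    by rewrite -zb -wc; lia.
  rewrite /= ad_mul /= in kx ly *; rewrite kx ly.
  by rewrite -scalerAl -scalerAr -scalerDl rmorphD.
Qed.

(** Since [ad h_odd] kills [z] and preserves parity, it kills the odd part of [z]. That part is a
    sum of eigenvectors with odd, hence nonzero, eigenvalues, so it vanishes. *)
Lemma central_even z : central z -> hom false z.
Proof.
move=> zC; have adz : ad h_odd z = 0 by rewrite /ad zC subrr.
have [z0 [z1 [h0 h1 zE]]] := env_split z.
have h_h : hom false h_odd.
  rewrite /h_odd; apply: (big_ind (hom false)) => [||i _].
  - exact: homog0.
  - by move=> x y; exact: homogD.
  - by rewrite -[false](addbb (par i)); exact: homog_e.
have had b x : hom b x -> hom b (ad h_odd x).
  move=> hx; rewrite /ad addrC -scaleN1r; apply: eh_lin.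
    by rewrite -[b]addbF; exact: eh_mul.
  exact: eh_mul h_h hx.
have E : ad h_odd z0 = - ad h_odd z1.
  by apply/eqP; rewrite -subr_eq0 opprK -linearD /= -zE adz.
have az1 : ad h_odd z1 = 0.
  apply: homog_disjoint; last exact: had.
  have := homogZ (-1) (had _ _ h0); rewrite E scaleN1r opprK; exact.
suff -> : z = z0 by [].
rewrite zE (eig_span_ker _ (homog_eig h1) az1) ?addr0 // => -[w [/eqP]].
by rewrite eq_sym intr_eq0 => /eqP ->.
Qed.

End Enveloping.

(** * From a highest weight functional to a simple highest weight supermodule *)

Section HarishChandraFunctional.
Variables (C : numFieldType) (m n : nat).
Variables (U : algType C) (iota : {linear 'M[C]_(m + n) -> U}).
Local Notation e i j := (iota (delta_mx i j)).
Local Notation hom := (env_homog iota).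

(* [c x] is the coefficient of [v] in [x v], for a highest weight vector [v] of
   weight [lam]. *)
Record hc_functional (lam : 'I_(m + n) -> C) (c : U -> C) : Prop := HcFunctional {
  hc_lin : forall a x y, c (a *: x + y) = a * c x + c y;
  hc_one : c 1 = 1;
  hc_raise : forall x (i j : 'I_(m + n)), (i < j)%N -> c (x * e i j) = 0;
  hc_lower : forall x (i j : 'I_(m + n)), (j < i)%N -> c (e i j * x) = 0;
  hc_diagr : forall x i, c (x * e i i) = lam i * c x;
  hc_diagl : forall x i, c (e i i * x) = lam i * c x
}.

Hypothesis U_env : is_enveloping iota.
Variables (lam : 'I_(m + n) -> C) (c : U -> C).
Hypothesis c_hc : hc_functional lam c.

Let c0 : c 0 = 0.
Proof. by have := hc_lin c_hc (-1) 0 0; rewrite scaler0 addr0 mulN1r addNr. Qed.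
Let cD x y : c (x + y) = c x + c y.
Proof. by rewrite -[x]scale1r (hc_lin c_hc) scale1r mul1r. Qed.
Let cZ a x : c (a *: x) = a * c x.
Proof. by rewrite -[_ *: _]addr0 (hc_lin c_hc) c0 addr0. Qed.
Let cB x y : c (x - y) = c x - c y.
Proof. by rewrite cD -scaleN1r cZ mulN1r. Qed.
Let c_sum I (r : seq I) P (F : I -> U) :
  c (\sum_(i <- r | P i) F i) = \sum_(i <- r | P i) c (F i).
Proof. exact: (big_morph c cD c0). Qed.

(** As [c] has the same weight on both sides, it kills all values of [ad h_odd], and an odd element
    is a sum of eigenvectors of [ad h_odd] with nonzero eigenvalues. *)
Let c_odd x : hom true x -> c x = 0.
Proof.
move=> /(homog_eig U_env); elim=> [k {}x [z [-> zb]] hx|a y z _ cy _ cz]; last first.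
  by rewrite (hc_lin c_hc) cy cz mulr0 addr0.
have /eqP : z%:~R * c x = 0.
  rewrite -cZ -hx /= /ad cB /h_odd mulr_suml mulr_sumr !c_sum -sumrB.
  by apply: big1 => i _; rewrite (hc_diagr c_hc) (hc_diagl c_hc) subrr.
by rewrite mulf_eq0 intr_eq0; case: eqP zb => [->|_ _ /eqP].
Qed.

Let is_coeff (f : U -> C^o) : Prop := exists x, f = (fun y => c (y * x)).

Let is_coeff_submodule : submodule is_coeff.
Proof.
split; first by exists 0; apply/funext => y; rewrite mulr0 c0.
move=> a f g [x ->] [y ->]; exists (a *: x + y); apply/funext => z.
by rewrite mulrDr -scalerAr (hc_lin c_hc).
Qed.

(* The simple highest weight module, realized as matrix coefficients: the image of
   [x v] is the function [y |-> c (y x)]. *)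
Let Q := sub_lmod is_coeff_submodule.

Let qv (x : U) : Q := in_sub_lmod is_coeff_submodule (ex_intro _ x erefl).

Let qvE x y : val (qv x) y = c (y * x). Proof. by []. Qed.

Let qv_surj (q : Q) : exists x, q = qv x.
Proof. by have [x qx] := sub_lmodP q; exists x; apply: val_inj. Qed.

Let qv_ext x y : (forall z, c (z * x) = c (z * y)) -> qv x = qv y.
Proof. by move=> E; apply: val_inj; apply/funext => z; exact: E. Qed.

Let qv_lin a x y : qv (a *: x + y) = a *: qv x + qv y.
Proof.
apply: val_inj; rewrite linearP /=; apply/funext => z /=.
by rewrite mulrDr -scalerAr (hc_lin c_hc).
Qed.

Let qv0 : qv 0 = 0.
Proof. by have := qv_lin (-1) 0 0; rewrite scaler0 addr0 scaleN1r addNr. Qed.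
Let qvZ a x : a *: qv x = qv (a *: x).
Proof. by rewrite -[a *: x]addr0 qv_lin qv0 addr0. Qed.
Let qvD x y : qv x + qv y = qv (x + y).
Proof. by rewrite -[x in RHS]scale1r qv_lin scale1r. Qed.
Let qvB x y : qv x - qv y = qv (x - y).
Proof. by rewrite -scaleN1r qvZ qvD scaleN1r. Qed.

Let act_subproof (u : U) (q : Q) : is_coeff (fun y => val q (y * u)).
Proof.
have [x ->] := qv_surj q; exists (u * x); apply/funext => y.
by rewrite qvE mulrA.
Qed.
Let act u q : Q := in_sub_lmod is_coeff_submodule (act_subproof u q).

Let act_qv u x : act u (qv x) = qv (u * x).
Proof. by apply: val_inj; apply/funext => y /=; rewrite mulrA. Qed.

Let act_lin u : linear (act u).
Proof.
move=> a q r; have [x ->] := qv_surj q; have [y ->] := qv_surj r.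
by rewrite -qv_lin !act_qv mulrDr -scalerAr qv_lin.
Qed.

Let qgr b (q : Q) := exists2 x, hom b x & q = qv x.

Let Q_supermodule : is_supermodule iota qgr act.
Proof.
split; [split| | |].
- move=> b; exists 0; first exact: homog0.
  by apply: val_inj; apply/funext => y /=; rewrite mulr0 c0.
- move=> b a q r [x hx ->] [y hy ->]; exists (a *: x + y); first exact: eh_lin.
  by rewrite qv_lin.
- move=> q; have [x ->] := qv_surj q; have [x0 [x1 [h0 h1 ->]]] := env_split U_env x.
  exists (qv x0), (qv x1); split; [by exists x0|by exists x1|].
  by rewrite -[x0]scale1r qv_lin !scale1r.
(* The argument is split by parity. Its odd part makes the product with the even [x] odd; for its
   even part [x] is exchanged for the odd [y] through [qE]. In both cases [c] vanishes. *)
- move=> q [x hx ->] [y hy qE]; apply: val_inj; apply/funext => z.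
  have [z0 [z1 [h0 h1 ->]]] := env_split U_env z.
  have E := congr1 (fun q : Q => val q z0) qE; rewrite /= in E.
  have zy : c (z0 * y) = 0 by apply: c_odd; exact: (eh_mul h0 hy).
  have zx : c (z1 * x) = 0 by apply: c_odd; exact: (eh_mul h1 hx).
  by rewrite /= mulrDl cD zx addr0 E zy.
- split=> [q a u v|u]; last exact: act_lin.
  have [x ->] := qv_surj q.
  by rewrite !act_qv mulrDl -scalerAl qv_lin.
- split=> [q|u v q]; have [x ->] := qv_surj q; first by rewrite act_qv mul1r.
  by rewrite !act_qv mulrA.
- move=> b d u q hu [x hx ->]; exists (u * x); first exact: eh_mul.
  by rewrite act_qv.
Qed.

(** A grading element under which $e_{ij}$ has degree $j - i$: lowering operators have negative
    degree, which separates the highest weight line from the rest. *)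
Let h0 : U := \sum_i - (nat_of_ord i)%:R *: e i i.

Let ad_h0 (i j : 'I_(m + n)) : ad h0 (e i j) = (j%:R - i%:R) *: e i j.
Proof.
have -> : ad h0 (e i j) = \sum_(k < m + n) - k%:R *: ad (e k k) (e i j).
  rewrite /ad /h0 mulr_suml mulr_sumr -sumrB; apply: eq_bigr => k _.
  by rewrite scalerBr -scalerAl -scalerAr.
rewrite (eq_bigr (fun k : 'I_(m + n) => (- k%:R * ((i == k)%:R - (j == k)%:R)) *: e i j)); last first.
  by move=> k _; rewrite (ad_diag U_env) scalerA.
rewrite -scaler_suml; congr (_ *: _).
have E (l : 'I_(m + n)) : \sum_(k < m + n) - k%:R * (l == k)%:R = - l%:R :> C.
  rewrite (bigD1 l) //= eqxx mulr1 big1 ?addr0 // => k /negPf kl.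
  by rewrite eq_sym kl mulr0.
under eq_bigr do rewrite mulrBr.
by rewrite sumrB !E opprK addrC.
Qed.

(** The index is the depth, the sum of the $i - j$ over the factors; the subtraction is exact since
    $j < i$. *)
Inductive lower_monomial : nat -> U -> Prop :=
| lower_one : lower_monomial 0 1
| lower_mul (i j : 'I_(m + n)) k x : (j < i)%N -> lower_monomial k x ->
    lower_monomial (k + (i - j)) (e i j * x).

Let ad_h0_lower k x : lower_monomial k x -> ad h0 x = - k%:R *: x.
Proof.
elim=> {k x} [|i j k x ji _ IH]; first by rewrite /ad mulr1 mul1r subrr oppr0 scale0r.
rewrite ad_mul ad_h0 IH -scalerAl -scalerAr -scalerDl natrD (natrB _ (ltnW ji)).
by congr (_ *: _); rewrite opprD opprB addrC.
Qed.

Inductive lower_span : Q -> Prop :=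
| lower_span_mono k x : lower_monomial k x -> lower_span (qv x)
| lower_span_lin a q r : lower_span q -> lower_span r -> lower_span (a *: q + r).

Let lower_span0 : lower_span 0.
Proof.
have := lower_span_lin (-1) (lower_span_mono lower_one) (lower_span_mono lower_one).
by rewrite scaleN1r addNr.
Qed.

Let lower_spanZ a q : lower_span q -> lower_span (a *: q).
Proof.
by move=> lq; rewrite -[_ *: _]addr0; apply: lower_span_lin lq lower_span0.
Qed.

Let lower_spanD q r : lower_span q -> lower_span r -> lower_span (q + r).
Proof. by move=> lq; rewrite -[q]scale1r; exact: lower_span_lin. Qed.

Let lower_span_act_lower (i j : 'I_(m + n)) q : (j < i)%N -> lower_span q ->
  lower_span (act (e i j) q).
Proof.
move=> ji; elim=> {q} [k x lx|a q r _ lq _ lr].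
  by rewrite act_qv; exact: lower_span_mono (lower_mul ji lx).
by rewrite act_lin; exact: lower_span_lin.
Qed.

(** The bracket moves $e_{ij}$ past the leftmost lowering operator, leaving matrix units that act on
    shorter monomials. On the empty monomial a raising operator gives 0 and a diagonal one a scalar.
    This plays the role of a triangular decomposition. *)
Let lower_span_act i j q : lower_span q -> lower_span (act (e i j) q).
Proof.
elim=> {q} [k x lx|a q r _ lq _ lr]; last by rewrite act_lin; exact: lower_span_lin.
elim: lx i j => {k x} [|a b k x ba lx IH] i j.
  rewrite act_qv mulr1; have [ij|ji|ij] := ltngtP (i : nat) j.
  - rewrite (_ : qv _ = 0) //; apply: val_inj; apply/funext => y /=.
    by rewrite (hc_raise c_hc).
  - by rewrite -[e i j]mulr1; exact: lower_span_mono (lower_mul ji lower_one).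
  - rewrite (val_inj ij) (_ : qv _ = lam j *: qv 1).
      by apply/lower_spanZ/(lower_span_mono lower_one).
    apply: val_inj; apply/funext => y; change (c (y * e j j) = lam j * c (y * 1)).
    by rewrite (hc_diagr c_hc) mulr1.
have -> : act (e i j) (qv (e a b * x)) =
    (-1) ^+ ((par i (+) par j) && (par a (+) par b)) *:
      act (e a b) (act (e i j) (qv x))
    + ((a == j)%:R *: act (e i b) (qv x)
       - (-1) ^+ ((par i (+) par j) && (par a (+) par b)) *:
           ((b == i)%:R *: act (e a j) (qv x))).
  rewrite !act_qv mulrA (env_bracket U_env); set s := (-1) ^+ _.
  rewrite !qvZ qvB qvD; congr qv.
  by rewrite mulrDl mulrBl -!scalerAl !mulrA.
apply: lower_spanD; first by apply/lower_spanZ/lower_span_act_lower => //; exact: IH.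
apply: lower_spanD; first by apply/lower_spanZ; exact: IH.
by rewrite -scaleN1r; do 3!apply: lower_spanZ; exact: IH.
Qed.

Let lower_span_all q : lower_span q.
Proof.
have [x ->] := qv_surj q; elim/(env_ind U_env): x => [|a x y lx ly|i j x lx].
- exact: lower_span_mono lower_one.
- by rewrite qv_lin; exact: lower_span_lin.
- by rewrite -act_qv; exact: lower_span_act.
Qed.

Let lam0 := \sum_i - (nat_of_ord i)%:R * lam i.

(** Subtracting the weight of [h0] makes [A] act on the class of [x] as [ad h0] acts on [x]; the
    highest weight vector gets eigenvalue 0. *)
Let A (q : Q) : Q := act h0 q - lam0 *: q.
Let A_lin : linear A.
Proof.
move=> a q r; rewrite /A act_lin scalerBr scalerDr scalerA mulrC -scalerA.
by rewrite opprD addrACA.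
Qed.
Let AL := HB.pack_for {linear Q -> Q} A (GRing.isLinear.Build _ _ _ _ A A_lin).

Let A_eig k x : ad h0 x = k *: x -> A (qv x) = k *: qv x.
Proof.
move=> hx; rewrite /A act_qv !qvZ qvB; apply: qv_ext => y.
rewrite (_ : h0 * x = k *: x + x * h0); last by rewrite -hx /ad subrK.
rewrite mulrBr mulrDr -!scalerAr cB cD !cZ mulrA [y * x * h0]mulr_sumr c_sum -addrA.
rewrite (_ : \sum_i _ = lam0 * c (y * x)) ?subrr ?addr0 //.
rewrite mulr_suml; apply: eq_bigr => i _.
by rewrite -scalerAr cZ (hc_diagr c_hc) mulrA.
Qed.

Let negative (k : C) : Prop := exists d, k = - d.+1%:R.

Let highest_part x : exists g, [/\ qv x = c x *: qv 1 + g & eig_span AL negative g].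
Proof.
have eig0 : eig_span AL negative 0.
  by apply: (@eig_vec _ _ _ _ (- 1%:R)); [exists 0%N|rewrite linear0 scaler0].
(* As evaluation at 1, the coefficient becomes a linear function of the vector, and the induction
   can run over the module instead of [U]. *)
have {1}-> : c x = val (qv x) 1 by rewrite /= mul1r.
elim: (lower_span_all (qv x)) => {x} [k x lx|a q r _ [g [qE gE]] _ [g' [rE g'E]]].
  case: lx => {k x} [|i j k x ji lx].
    by exists 0; split=> //; rewrite /= mul1r (hc_one c_hc) scale1r addr0.
  exists (qv (e i j * x)); split.
    by rewrite /= mul1r (hc_lower c_hc) // scale0r add0r.
  apply: (@eig_vec _ _ _ _ (- (k + (i - j))%:R)).
    exists (k + (i - j)).-1; rewrite prednK // addn_gt0 subn_gt0 ji orbT //.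
  exact/A_eig/ad_h0_lower/lower_mul.
exists (a *: g + g'); split; last exact: eig_lin.
by rewrite {1}qE {1}rE /= scalerDr scalerA scalerDl addrACA.
Qed.

(** A nonzero coefficient function takes a nonzero value [c (y * x)] at some [y]. Then [y * x] has a
    nonzero component along the highest weight vector, which absorption extracts, and this vector
    generates the module. *)
Let Q_simple : is_simple qgr act.
Proof.
split.
  exists (qv 1); apply/eqP => /(congr1 (fun q : Q => val q 1)) /=.
  by rewrite mulr1 (hc_one c_hc); move/eqP; rewrite oner_eq0.
move=> W [W0 Wlin Wact _].
have [W1|nW1] := pselect (W (qv 1)).
  by right=> q; have [x ->] := qv_surj q; rewrite -[x]mulr1 -act_qv; exact: Wact.
left=> q; have [x ->] := qv_surj q => Wx; apply: val_inj; apply/funext => y /=.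
apply: contrapT => /eqP cyx; case: nW1.
have [g [E gE]] := highest_part (y * x).
suff : W (c (y * x) *: qv 1).
  by move=> /(Wlin (c (y * x))^-1 _ _)/(_ W0); rewrite addr0 scalerA mulVf // scale1r.
apply: (@eig_span_absorb _ _ AL negative W _ g) => //.
- by move=> r Wr; rewrite /= /A addrC -scaleNr; apply: Wlin => //; exact: Wact.
- by case=> d /eqP; rewrite eq_sym oppr_eq0 pnatr_eq0.
- have A1 : A (qv 1) = 0 *: qv 1.
    by apply: A_eig; rewrite /ad mulr1 mul1r subrr scale0r.
  by rewrite linearZ /= A1 scale0r scaler0.
- by rewrite -E -act_qv; exact: Wact.
Qed.

(** The central element acts on the highest weight vector of the simple module by the Harish-Chandra
    scalar; evaluating this equality of functions at [y] gives the formula. *)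
Lemma hc_functional_central (chi : U -> {mpoly C[m + n]}) :
  is_harish_chandra iota chi -> forall z, central z -> forall y,
  c (y * z) = (chi z).@[fun i => lam i + rho C i] * c y.
Proof.
case=> _ _ _ chiE z zC y.
have hw : is_highest_weight_vector iota qgr act lam (qv 1).
  split.
  - apply/eqP => /(congr1 (fun q : Q => val q 1)) /=.
    by rewrite mulr1 (hc_one c_hc); move/eqP; rewrite oner_eq0.
  - by exists false; exists 1 => //; exact: eh_one.
  - move=> i j ij; rewrite act_qv mulr1 -qv0; apply: qv_ext => w.
    by rewrite mulr0 c0 (hc_raise c_hc).
  - move=> i; rewrite act_qv qvZ mulr1; apply: qv_ext => w.
    by rewrite (hc_diagr c_hc) -scalerAr cZ mulr1.
have := chiE Q qgr act lam (qv 1) Q_supermodule Q_simple hw z zC (qv 1).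
rewrite act_qv qvZ mulr1 => /(congr1 (fun q : Q => val q y)); rewrite !qvE => ->.
by rewrite -scalerAr cZ mulr1.
Qed.
End HarishChandraFunctional.

(** * Bosonic and fermionic operators on a Fock space *)

Section FockOperators.
Variables (C : fieldType) (M N : nat).
Local Notation mon := (mon M N).
Local Notation bas := (@bas C M N).
Local Notation End := (endF C M N).

Lemma coeff_bas (x y : mon) : coeff x (bas y) = (x == y)%:R.
Proof. by rewrite coeffU mul1r eq_sym. Qed.

Lemma endF_bas_ext (f g : End) : (forall x, f (bas x) = g (bas x)) -> f = g.
Proof. by move=> fg; apply/endF_ext/lin_bas_ext => //; exact: efunP. Qed.

(** Multiplying by a fixed basis vector turns a functional into an endomorphism, for which
    extensionality on the basis is known. *)
Lemma fock_scalar_ext (F G : fockT C M N -> C) :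
  (forall a u v, F (a *: u + v) = a * F u + F v) ->
  (forall a u v, G (a *: u + v) = a * G u + G v) ->
  (forall x, F (bas x) = G (bas x)) -> F =1 G.
Proof.
move=> lF lG FG u; pose x0 := t0pow M N 0.
have : F u *: bas x0 = G u *: bas x0.
  apply: (@lin_bas_ext C M N (fun u => F u *: bas x0) (fun u => G u *: bas x0)).
  - by move=> a v w; rewrite lF scalerDl scalerA.
  - by move=> a v w; rewrite lG scalerDl scalerA.
  - by move=> x; rewrite FG.
by move/(congr1 (coeff x0)); rewrite !coeffZ coeff_bas eqxx !mulr1.
Qed.

Lemma endFM (f g : End) u : (f * g) u = f (g u). Proof. by []. Qed.
Lemma endFB (f g : End) u : (f - g) u = f u - g u. Proof. by []. Qed.
Lemma endFN (f : End) u : (- f) u = - f u. Proof. by []. Qed.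
Lemma endFD (f g : End) u : (f + g) u = f u + g u. Proof. by []. Qed.
Lemma endFZl a (f : End) u : (a *: f) u = a *: f u. Proof. by []. Qed.
Lemma endF1 u : (1 : End) u = u. Proof. by []. Qed.

Lemma endF_sum I r (P : pred I) (F : I -> End) u :
  (\sum_(i <- r | P i) F i) u = \sum_(i <- r | P i) F i u.
Proof. exact: (big_morph (fun f : End => f u)). Qed.

Lemma endF0 (f : End) : f 0 = 0.
Proof. by have := efunP f (-1) 0 0; rewrite scaler0 addr0 scaleN1r addNr. Qed.

Lemma endFZ (f : End) a u : f (a *: u) = a *: f u.
Proof. by have := efunP f a u 0; rewrite !endF0 !addr0. Qed.

(** Operators sending each monomial to a multiple of a monomial. Relations between them reduce to
    identities of coefficients and of maps on monomials. *)
Definition opr (k : mon -> C) (s : mon -> mon) : End :=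
  EndF (linext_linear (fun x => k x *: bas (s x))).

Lemma opr_bas k s x : opr k s (bas x) = k x *: bas (s x).
Proof. by rewrite /= linext_bas. Qed.

Lemma opr_mul k s k' s' :
  opr k s * opr k' s' = opr (fun x => k' x * k (s' x)) (s \o s').
Proof.
apply: endF_bas_ext => x.
by rewrite [LHS](_ : _ = opr k s (opr k' s' (bas x))) // !opr_bas endFZ opr_bas scalerA.
Qed.

Lemma opr_eq k s k' s' : k =1 k' -> s =1 s' -> opr k s = opr k' s'.
Proof. by move=> kk ss; apply: endF_bas_ext => x; rewrite !opr_bas kk ss. Qed.

Lemma opr1 : opr (fun=> 1) id = 1.
Proof. by apply: endF_bas_ext => x; rewrite opr_bas scale1r. Qed.

Lemma opr_comm k s k' s' : (forall x, s (s' x) = s' (s x)) ->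
  (forall x, k (s' x) = k x) -> (forall x, k' (s x) = k' x) ->
  opr k s * opr k' s' = opr k' s' * opr k s.
Proof.
by move=> ss kk kk'; rewrite !opr_mul; apply: opr_eq => // x; rewrite kk kk' mulrC.
Qed.

Definition toggle (j : 'I_N) (S : {set 'I_N}) : {set 'I_N} :=
  [set s | (s \in S) (+) (s == j)].
(** A product over all smaller modes, occupied or not, so that toggling one mode changes exactly one
    factor. *)
Definition fsign (j : 'I_N) (S : {set 'I_N}) : C :=
  \prod_(s : 'I_N | (s < j)%N) (-1) ^+ (s \in S).

Lemma toggleC i j S : toggle i (toggle j S) = toggle j (toggle i S).
Proof. by apply/setP => s; rewrite !inE addbAC. Qed.

Lemma toggleK j S : toggle j (toggle j S) = S.
Proof. by apply/setP => s; rewrite !inE addbK. Qed.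

Lemma fsign_toggle i j S : fsign i (toggle j S) = (-1) ^+ (j < i)%N * fsign i S.
Proof.
have E (s : 'I_N) : s != j -> (s \in toggle j S) = (s \in S).
  by rewrite inE => /negPf ->; rewrite addbF.
rewrite /fsign; case: ltnP => ji.
  rewrite (bigD1 j) //= [in RHS](bigD1 j) //= inE eqxx addbT signrN mulN1r mulNr.
  by congr (- (_ * _)); apply: eq_bigr => s /andP[_ /E ->].
rewrite mul1r; apply: eq_bigr => s si; rewrite E //.
by apply: contraTneq si => ->; rewrite -leqNgt.
Qed.

Lemma fsign_sq i S : fsign i S * fsign i S = 1.
Proof.
rewrite /fsign -big_split big1 // => s _.
by rewrite /= -signr_addb addbb.
Qed.

(* Jordan-Wigner: the [theta j] anticommute and square to 1, which reduces the fermionic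
   relations to those of [theta] with the occupation numbers. *)
Definition theta j := opr (fun x => fsign j x.2) (fun x => (x.1, toggle j x.2)).
Definition occ (j : 'I_N) := opr (fun x => (j \in x.2)%:R) id.

Lemma theta_sq j : theta j * theta j = 1.
Proof.
rewrite /theta opr_mul -opr1; apply: opr_eq => [[b S]|[b S]] /=.
  by rewrite fsign_toggle ltnn mul1r fsign_sq.
by rewrite toggleK.
Qed.

Lemma theta_anticomm i j : i != j -> theta i * theta j = - (theta j * theta i).
Proof.
move=> ij; rewrite /theta !opr_mul.
rewrite -[RHS]scaleN1r; apply: endF_bas_ext => -[b S].
rewrite [RHS](_ : _ = -1 *: (opr (fun x => fsign i x.2 * fsign j (toggle i x.2))
  ((fun x => (x.1, toggle j x.2)) \o (fun x => (x.1, toggle i x.2)))) (bas (b, S))) //.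
rewrite !opr_bas /= toggleC scalerA !fsign_toggle; congr (_ *: _).
move: ij; rewrite -val_eqE neq_ltn /= => /orP[] lt; rewrite lt ltnNge (ltnW lt) /=; ring.
Qed.

Lemma occ_theta j : occ j * theta j = theta j * (1 - occ j).
Proof.
rewrite /occ /theta mulrBr mulr1 !opr_mul; apply: endF_bas_ext => -[b S].
rewrite [RHS](_ : _ = opr (fun x => fsign j x.2) (fun x => (x.1, toggle j x.2)) (bas (b, S))
  - opr (fun x => (j \in x.2)%:R * fsign j x.2) ((fun x => (x.1, toggle j x.2)) \o id) (bas (b, S))) //.
rewrite !opr_bas /= !inE eqxx addbT -scalerBl; congr (_ *: _).
by case: (j \in S); rewrite ?mulr0 ?mulr1 ?mul1r ?mul0r ?subrr ?subr0.
Qed.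

Lemma occC_theta j : (1 - occ j) * theta j = theta j * occ j.
Proof. by rewrite mulrBl mul1r occ_theta mulrBr mulr1 opprB addrC subrK. Qed.

Lemma occ_theta_comm i j : i != j -> occ i * theta j = theta j * occ i.
Proof.
move=> ij; apply: opr_comm => [//|x|//] /=.
by rewrite inE (negPf ij) addbF.
Qed.

Lemma occ_comm i j : occ i * occ j = occ j * occ i.
Proof. exact: opr_comm. Qed.

Lemma occ_idem j : occ j * occ j = occ j.
Proof.
by rewrite /occ opr_mul; apply: opr_eq => // x; rewrite -natrM mulnb andbb.
Qed.

(** Creation and annihilation operators: the projection restricts [theta j] to the empty,
    respectively occupied, states. *)
Definition psi j := theta j * (1 - occ j).
Definition dpsi j := theta j * occ j.

Lemma psi_dpsi j : psi j * dpsi j = occ j.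
Proof.
rewrite /psi /dpsi mulrA -[theta j * (1 - occ j) * _]mulrA occC_theta.
by rewrite mulrA theta_sq mul1r occ_idem.
Qed.

Lemma dpsi_psi j : dpsi j * psi j = 1 - occ j.
Proof.
rewrite /psi /dpsi mulrA -[theta j * occ j * _]mulrA occ_theta mulrA theta_sq mul1r.
by rewrite mulrBr mulr1 mulrBl mul1r occ_idem subrr subr0.
Qed.

Lemma psi_psi j : psi j * psi j = 0.
Proof.
rewrite /psi mulrA -[theta j * (1 - occ j) * _]mulrA occC_theta.
by rewrite mulrA theta_sq mul1r mulrBr mulr1 occ_idem subrr.
Qed.

Lemma dpsi_dpsi j : dpsi j * dpsi j = 0.
Proof.
rewrite /dpsi mulrA -[theta j * occ j * _]mulrA occ_theta mulrA theta_sq mul1r.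
by rewrite mulrBl mul1r occ_idem subrr.
Qed.

Lemma theta_anticomm_diag i j p q : i != j ->
  p * theta j = theta j * p -> q * theta i = theta i * q -> p * q = q * p ->
  theta i * p * (theta j * q) = - (theta j * q * (theta i * p)).
Proof.
move=> ij pj qi pq; rewrite mulrA -[theta i * p * _]mulrA pj mulrA.
rewrite theta_anticomm // [theta j * q * _]mulrA -[theta j * q * _]mulrA qi.
by rewrite !mulNr -!mulrA pq.
Qed.

Lemma fermi_anticomm i j : i != j ->
  [/\ psi i * psi j = - (psi j * psi i), dpsi i * dpsi j = - (dpsi j * dpsi i)
    & dpsi i * psi j = - (psi j * dpsi i)].
Proof.
move=> ij; have ji : j != i by rewrite eq_sym.
have E k l : k != l -> (1 - occ k) * theta l = theta l * (1 - occ k).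
  by move=> kl; rewrite mulrBl mulrBr mul1r mulr1 occ_theta_comm.
have F k l : occ k * (1 - occ l) = (1 - occ l) * occ k.
  by rewrite mulrBl mulrBr mul1r mulr1 occ_comm.
have G k l : (1 - occ k) * (1 - occ l) = (1 - occ l) * (1 - occ k).
  by rewrite [LHS]mulrBr mulr1 -F [RHS]mulrBl mul1r.
have O k l (kl : k != l) := occ_theta_comm kl.
rewrite /psi /dpsi; split.
- exact: (theta_anticomm_diag ij (E _ _ ij) (E _ _ ji) (G i j)).
- exact: (theta_anticomm_diag ij (O _ _ ij) (O _ _ ji) (occ_comm i j)).
- exact: (theta_anticomm_diag ij (O _ _ ij) (E _ _ ji) (F i j)).
Qed.

Definition bplus (a : 'I_M) (x : mon) : mon :=
  (x.1.1, [ffun b => (x.1.2 b + (b == a))%N], x.2).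
(** The subtraction truncates at exponent 0, where the coefficient in [dbos] vanishes. *)
Definition bminus (a : 'I_M) (x : mon) : mon :=
  (x.1.1, [ffun b => (x.1.2 b - (b == a))%N], x.2).
Definition bos a := opr (fun=> 1) (bplus a).
Definition dbos a := opr (fun x => (x.1.2 a)%:R) (bminus a).

Lemma bosC a b : bos a * bos b = bos b * bos a.
Proof.
apply: opr_comm => // -[[k f] S]; congr (_, _, _); apply/ffunP => i.
by rewrite !ffunE /= addnAC.
Qed.

Lemma dbosC a b : dbos a * dbos b = dbos b * dbos a.
Proof.
rewrite /dbos !opr_mul; apply: opr_eq => -[[k f] S] /=.
  rewrite !ffunE [b == a]eq_sym; case: eqVneq => [->|_] //.
  by rewrite !subn0 mulrC.
by congr (_, _, _); apply/ffunP => i; rewrite !ffunE /= subnAC.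
Qed.

Lemma dbos_bos a b : dbos a * bos b = bos b * dbos a + (a == b)%:R.
Proof.
rewrite /dbos /bos !opr_mul; apply: endF_bas_ext => -[[k f] S].
rewrite -scaler_nat.
rewrite [RHS](_ : _ = opr (fun x => (x.1.2 a)%:R * 1) (bplus b \o bminus a) (bas (k, f, S))
  + (a == b)%:R *: bas (k, f, S)) //.
rewrite !opr_bas /= !ffunE mul1r mulr1.
case: eqVneq => [->|ab]; last first.
  rewrite addn0 scale0r addr0; congr (_ *: bas (_, _, _)); apply/ffunP => i.
  rewrite !ffunE /=; case: eqVneq => [->|_]; last by rewrite !addn0.
  by rewrite eq_sym (negPf ab) !subn0.
have -> : bminus b (bplus b (k, f, S)) = (k, f, S).
  by congr (_, _, _); apply/ffunP => i; rewrite !ffunE /= addnK.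
rewrite natrD scalerDl; congr (_ + _).
case: (posnP (f b)) => [->|fb]; first by rewrite !scale0r.
congr (_ *: bas (_, _, _)); apply/ffunP => i; rewrite !ffunE /=.
by case: eqVneq => [->|_]; rewrite ?subn0 ?addn0 // subnK.
Qed.
End FockOperators.

(** * Oscillator representations of the general linear superalgebra *)

Section OscillatorRepresentation.
Variables (C : fieldType) (m n : nat) (A : algType C).
Local Notation I := 'I_(m + n).

Lemma mx_linear_eq0 (F : 'M[C]_(m + n) -> A) (x : 'M[C]_(m + n)) : linear F ->
  (forall i j, x i j != 0 -> F (delta_mx i j) = 0) -> F x = 0.
Proof.
move=> F_lin Fx; pose FL := HB.pack_for {linear 'M[C]_(m + n) -> A} F
  (GRing.isLinear.Build _ _ _ _ F F_lin).
rewrite -[F]/(FL : _ -> _) [x]matrix_sum_delta linear_sum big1 // => i _.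
rewrite linear_sum big1 // => j _; rewrite linearZ /=.
by have [->|/Fx ->] := eqVneq (x i j) 0; rewrite ?scale0r ?scaler0.
Qed.

Lemma linear_subZ (V W : lmodType C) (s : C) (F G : V -> W) :
  linear F -> linear G -> linear (fun u => F u - s *: G u).
Proof.
move=> F_lin G_lin a u v; rewrite F_lin G_lin !scalerDr scalerN !scalerA mulrC.
by rewrite opprD addrACA.
Qed.

(** With the sign fixed, the defect [B] is bilinear, so it is enough to kill it at the nonzero
    entries of [x] and [y]; there homogeneity identifies the fixed sign with that of the matrix
    units. *)
Lemma super_rep_basis (f : {linear 'M[C]_(m + n) -> A}) :
  (forall i j k l, let s := (-1) ^+ ((par i (+) par j) && (par k (+) par l)) in
     f (delta_mx i j) * f (delta_mx k l) = s *: (f (delta_mx k l) * f (delta_mx i j))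
       + ((k == j)%:R *: f (delta_mx i l) - s *: ((l == i)%:R *: f (delta_mx k j)))) ->
  super_rep f.
Proof.
move=> f_basis b c x y hx hy; apply/eqP; rewrite -subr_eq0; apply/eqP.
set s := (-1) ^+ _.
(* The factor 1 gives the outer difference the shape required by [linear_subZ]. *)
pose B u v := f (u *m v) - s *: f (v *m u) - 1 *: (f u * f v - s *: (f v * f u)).
rewrite linearB linearZ /= -[X in _ - X]scale1r -[LHS]/(B x y).
have B_linl v : linear (B^~ v).
  do 2!apply: linear_subZ => [|] //; move=> a u u';
    by rewrite ?mulmxDl ?mulmxDr -?scalemxAl -?scalemxAr linearP
      ?mulrDl ?mulrDr -?scalerAl -?scalerAr.
have B_linr u : linear (B u).
  do 2!apply: linear_subZ => [|] //; move=> a v v';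
    by rewrite ?mulmxDl ?mulmxDr -?scalemxAl -?scalemxAr linearP
      ?mulrDl ?mulrDr -?scalerAl -?scalerAr.
apply: mx_linear_eq0 (B_linl y) _ => i j xij; apply: mx_linear_eq0 (B_linr _) _ => k l ykl.
have E := f_basis i j k l; rewrite /= (hx _ _ xij) (hy _ _ ykl) -/s in E.
rewrite /B E !mul_delta_mx_cond !linearMn /= !scaler_nat scale1r.
by rewrite [j == k]eq_sym [X in _ - (X - _)]addrC addrK -scalerMnr mulNrn subrr.
Qed.

Variables (P : finType) (pi : P -> bool) (X Y : I * P -> A).
Let pj (j : I * P) := par j.1 (+) pi j.2.

Hypothesis XX : forall j k, X j * X k = (-1) ^+ (pj j && pj k) *: (X k * X j).
Hypothesis YY : forall j k, Y j * Y k = (-1) ^+ (pj j && pj k) *: (Y k * Y j).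
Hypothesis YX : forall j k,
  Y j * X k = (-1) ^+ (pj j && pj k) *: (X k * Y j) + (j == k)%:R.

(** Moving [Y k] past [X l] on the left, and [Y r] past [X j] on the right, produces the two
    contractions. The remaining quartic terms differ by reorderings of two [X] and of two [Y], whose
    total sign is [s]. *)
Lemma osc_quad j k l r :
  let s := (-1) ^+ ((pj j (+) pj k) && (pj l (+) pj r)) in
  X j * Y k * (X l * Y r) = s *: (X l * Y r * (X j * Y k))
    + ((k == l)%:R *: (X j * Y r) - s *: ((r == j)%:R *: (X l * Y k))).
Proof.
move=> s; have -> : X j * Y k * (X l * Y r) = X j * (Y k * X l) * Y r by rewrite !mulrA.
have -> : X l * Y r * (X j * Y k) = X l * (Y r * X j) * Y k by rewrite !mulrA.
rewrite !YX !mulrDr !mulrDl addrA [in RHS]addrAC; congr (_ + _); last first.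
  by rewrite mulr_natr scaler_nat mulrnAl.
rewrite scalerDr mulr_natr mulrnAl scaler_nat addrK.
rewrite -!scalerAr -!scalerAl !scalerA.
have -> : X j * (X l * Y k) * Y r = X j * X l * (Y k * Y r) by rewrite !mulrA.
rewrite XX YY -!scalerAl -!scalerAr !scalerA !mulrA; congr (_ *: _).
rewrite /s -!signr_addb; congr (_ ^+ _).
by case: (pj j); case: (pj k); case: (pj l); case: (pj r).
Qed.

(** The sum runs over the copies of the natural module. The parity [pi p] occurs in both factors and
    cancels, so copies of either parity may be mixed. *)
Definition osc i j := \sum_p X (i, p) * Y (j, p).

Lemma osc_bracket i j k l :
  let s := (-1) ^+ ((par i (+) par j) && (par k (+) par l)) in
  osc i j * osc k l = s *: (osc k l * osc i j)
    + ((k == j)%:R *: osc i l - s *: ((l == i)%:R *: osc k j)).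
Proof.
move=> s; have E p q : X (i, p) * Y (j, p) * (X (k, q) * Y (l, q)) =
   s *: (X (k, q) * Y (l, q) * (X (i, p) * Y (j, p)))
    + (((k == j) && (p == q))%:R *: (X (i, p) * Y (l, q))
       - s *: (((l == i) && (p == q))%:R *: (X (k, q) * Y (j, p)))).
  have par_pj i' j' r : pj (i', r) (+) pj (j', r) = par i' (+) par j'.
    by rewrite /pj /=; case: (pi r); case: (par i'); case: (par j').
  by rewrite osc_quad !par_pj !xpair_eqE [j == k]eq_sym [q == p]eq_sym.
have D (b : bool) (F : P -> P -> A) :
    \sum_p \sum_q (b && (p == q))%:R *: F p q = b%:R *: \sum_p F p p.
  rewrite scaler_sumr; apply: eq_bigr => p _.
  rewrite (bigD1 p) //= eqxx andbT big1 ?addr0 // => q /negPf qp.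
  by rewrite eq_sym qp andbF scale0r.
rewrite /osc mulr_suml; under eq_bigr => p _.
  rewrite mulr_sumr; under eq_bigr do rewrite E.
  rewrite big_split sumrB /= -!scaler_sumr; over.
rewrite big_split sumrB /= -!scaler_sumr D; congr (_ *: _ + (_ - _ *: _)).
  rewrite exchange_big mulr_suml; apply: eq_bigr => q _; by rewrite mulr_sumr.
by rewrite (D _ (fun p q => X (k, q) * Y (j, p))).
Qed.

Lemma osc_rep : exists2 f : {linear 'M[C]_(m + n) -> A},
  super_rep f & forall i j, f (delta_mx i j) = osc i j.
Proof.
pose f (a : 'M[C]_(m + n)) := \sum_i \sum_j a i j *: osc i j.
have f_lin : linear f.
  move=> a x y; rewrite /f scaler_sumr -big_split; apply: eq_bigr => i _ /=.
  rewrite scaler_sumr -big_split; apply: eq_bigr => j _ /=.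
  by rewrite !mxE scalerDl scalerA.
pose fL := HB.pack_for {linear 'M[C]_(m + n) -> A} f
  (GRing.isLinear.Build _ _ _ _ f f_lin).
have fE i j : fL (delta_mx i j) = osc i j.
  rewrite /= /f (bigD1 i) //= (bigD1 j) //= mxE !eqxx scale1r.
  rewrite !big1 ?addr0 // => [k /negPf ki|k /negPf kj].
    by rewrite big1 // => l _; rewrite mxE ki scale0r.
  by rewrite mxE kj andbF scale0r.
exists fL => //; apply: super_rep_basis => i j k l; rewrite !fE.
exact: osc_bracket.
Qed.
End OscillatorRepresentation.

(** * Highest weight functionals from filled vacua *)

Section FockFunctional.
Variables (C : numFieldType) (m n K : nat) (al : 'I_(m + n) -> nat).
Hypothesis al_le : forall i, (al i <= K)%N.
Hypothesis al_mono : forall i j : 'I_(m + n),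
  (i < j)%N -> par i = par j -> (al j <= al i)%N.

Local Notation I := 'I_(m + n).
Local Notation P := (bool * 'I_K)%type.
Let N := #|{: I * P}|.
Let rk (j : I * P) : 'I_N := enum_rank j.

Let fermi (j : I * P) := par j.1 (+) j.2.1.
Let filled (j : I * P) := if fermi j then (j.2.2 < al j.1)%N else ~~ j.2.1.

(* Each copy [(t, k)] of the natural module has a creation operator [X] and an
   annihilation operator [Y] for every index, of parity [fermi].  For [t = false] the
   bosons are exchanged, [X] being d_b and [Y] being - b: the vacuum is then killed by
   the [X], so that these modes count as filled and shift the even weights by [- K]. *)
Let X (j : I * P) : endF C N N :=
  if fermi j then psi C N (rk j) else if j.2.1 then bos C N (rk j) else dbos C N (rk j).
Let Y (j : I * P) : endF C N N :=
  if fermi j then dpsi C N (rk j) else if j.2.1 then dbos C N (rk j) else - bos C N (rk j).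

Local Notation bas := (@bas C N N).

Let rk_neq j k : j != k -> rk j != rk k.
Proof. by rewrite (inj_eq enum_rank_inj). Qed.

Let comm_bf (b : endF C N N) : (forall j, b * theta C N j = theta C N j * b) ->
  (forall j, b * occ C N j = occ C N j * b) ->
  forall j, b * psi C N j = psi C N j * b /\ b * dpsi C N j = dpsi C N j * b.
Proof.
move=> bt bo j; rewrite /psi /dpsi !mulrA bt -!mulrA bo; split=> //.
by rewrite mulrBr mulrBl mulr1 mul1r bo.
Qed.

Let bos_f a j : bos C N a * psi C N j = psi C N j * bos C N a /\
  bos C N a * dpsi C N j = dpsi C N j * bos C N a.
Proof. by apply: comm_bf => k; apply: opr_comm. Qed.

Let dbos_f a j : dbos C N a * psi C N j = psi C N j * dbos C N a /\
  dbos C N a * dpsi C N j = dpsi C N j * dbos C N a.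
Proof. by apply: comm_bf => k; apply: opr_comm. Qed.

Let XX j k : X j * X k = (-1) ^+ (fermi j && fermi k) *: (X k * X j).
Proof.
have [->|jk] := eqVneq j k.
  by rewrite andbb /X; case: (fermi k); rewrite ?psi_psi ?scaler0 // scale1r.
have rjk := rk_neq jk; have [ff _ _] := fermi_anticomm C N rjk.
rewrite /X; case: (fermi j); case: (fermi k); rewrite /= ?expr1 ?expr0 ?scale1r.
- by rewrite scaleN1r.
- by case: (k.2.1); [rewrite (bos_f _ _).1|rewrite (dbos_f _ _).1].
- by case: (j.2.1); [rewrite (bos_f _ _).1|rewrite (dbos_f _ _).1].
- case: (j.2.1); case: (k.2.1); first exact: bosC.
  + by rewrite [RHS]dbos_bos eq_sym (negPf rjk) addr0.
  + by rewrite [LHS]dbos_bos (negPf rjk) addr0.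
  + exact: dbosC.
Qed.

Let YY j k : Y j * Y k = (-1) ^+ (fermi j && fermi k) *: (Y k * Y j).
Proof.
have [->|jk] := eqVneq j k.
  by rewrite andbb /Y; case: (fermi k); rewrite ?dpsi_dpsi ?scaler0 // scale1r.
have rjk := rk_neq jk; have [_ ff _] := fermi_anticomm C N rjk.
rewrite /Y; case: (fermi j); case: (fermi k); rewrite /= ?expr1 ?expr0 ?scale1r.
- by rewrite scaleN1r.
- by case: (k.2.1); rewrite ?mulrN ?mulNr ?(bos_f _ _).2 ?(dbos_f _ _).2.
- by case: (j.2.1); rewrite ?mulrN ?mulNr ?(bos_f _ _).2 ?(dbos_f _ _).2.
- case: (j.2.1); case: (k.2.1); first exact: dbosC.
  + by rewrite mulrN mulNr [in LHS]dbos_bos (negPf rjk) addr0.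
  + by rewrite mulrN mulNr [in RHS]dbos_bos eq_sym (negPf rjk) addr0.
  + by rewrite !mulrN !mulNr !opprK; exact: bosC.
Qed.

Let YX j k : Y j * X k = (-1) ^+ (fermi j && fermi k) *: (X k * Y j) + (j == k)%:R.
Proof.
have [->|jk] := eqVneq j k.
  rewrite andbb /X /Y; case: (fermi k); rewrite /= ?expr1 ?expr0 ?scale1r ?scaleN1r.
    by rewrite psi_dpsi dpsi_psi addrC.
  case: (k.2.1); first by rewrite dbos_bos eqxx.
  by rewrite mulrN mulNr [in RHS]dbos_bos eqxx opprD addrNK.
have rjk := rk_neq jk; have [_ _ ff] := fermi_anticomm C N rjk.
rewrite addr0 /X /Y; case: (fermi j); case: (fermi k); rewrite /= ?expr1 ?expr0 ?scale1r.
- by rewrite scaleN1r.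
- by case: (k.2.1); rewrite ?(bos_f _ _).2 ?(dbos_f _ _).2.
- by case: (j.2.1); rewrite ?mulrN ?mulNr ?(bos_f _ _).1 ?(dbos_f _ _).1.
- case: (j.2.1); case: (k.2.1).
  + by rewrite [LHS]dbos_bos (negPf rjk) addr0.
  + exact: dbosC.
  + by rewrite mulrN mulNr; congr (- _); exact: bosC.
  + by rewrite mulrN mulNr [in RHS]dbos_bos eq_sym (negPf rjk) addr0.
Qed.

Let v0 : mon N N :=
  (0, [ffun=> 0%N], [set r | fermi (enum_val r) && filled (enum_val r)]).

Let v0_rk j : (rk j \in v0.2) = fermi j && filled j.
Proof. by rewrite inE /rk enum_rankK. Qed.

Let theta_bas j (x : mon N N) : theta C N j (bas x) = fsign C j x.2 *: bas (x.1, toggle j x.2).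
Proof. exact: opr_bas. Qed.
Let occ_bas j (x : mon N N) : occ C N j (bas x) = (j \in x.2)%:R *: bas x.
Proof. exact: opr_bas. Qed.
Let psi_bas j (x : mon N N) : psi C N j (bas x) =
  ((j \notin x.2)%:R * fsign C j x.2) *: bas (x.1, toggle j x.2).
Proof.
rewrite [LHS](_ : _ = theta C N j (bas x - occ C N j (bas x))) //.
rewrite occ_bas -{1}[bas x]scale1r -scalerBl endFZ theta_bas scalerA.
by case: (j \in x.2); rewrite ?subrr ?subr0.
Qed.
Let dpsi_bas j (x : mon N N) : dpsi C N j (bas x) =
  ((j \in x.2)%:R * fsign C j x.2) *: bas (x.1, toggle j x.2).
Proof.
rewrite [LHS](_ : _ = theta C N j (occ C N j (bas x))) //.
by rewrite occ_bas endFZ theta_bas scalerA.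
Qed.

Let coeff_eq0 (f : endF C N N) (k : mon N N -> C) s :
  (forall x, f (bas x) = k x *: bas (s x)) ->
  (forall x, s x = v0 -> k x = 0) -> forall u, coeff v0 (f u) = 0.
Proof.
move=> fE ks; apply: (fock_scalar_ext (F := fun u => coeff v0 (f u)) (G := fun=> 0)).
- by move=> a u w; rewrite efunP coeffD coeffZ.
- by move=> a u w; rewrite mulr0 addr0.
- move=> x; rewrite fE coeffZ coeff_bas.
  by have [/esym /ks ->|_] := eqVneq v0 (s x); rewrite ?mul0r ?mulr0.
Qed.

Let X_v0 j : filled j -> X j (bas v0) = 0.
Proof.
rewrite /X => fj; have := v0_rk j; rewrite fj andbT.
case f: (fermi j) => rj; first by rewrite psi_bas rj mul0r scale0r.
move: fj; rewrite /filled f => /negPf ->.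
by rewrite /dbos opr_bas /= ffunE scale0r.
Qed.

Let Y_v0 j : ~~ filled j -> Y j (bas v0) = 0.
Proof.
rewrite /Y => fj; have := v0_rk j; rewrite (negPf fj) andbF.
case f: (fermi j) => rj; first by rewrite dpsi_bas rj mul0r scale0r.
move: fj; rewrite /filled f negbK => ->.
by rewrite /dbos opr_bas /= ffunE scale0r.
Qed.

Let X_coeff j u : ~~ filled j -> coeff v0 (X j u) = 0.
Proof.
rewrite /X => fj; have := v0_rk j; rewrite (negPf fj) andbF.
case f: (fermi j) => rj.
  apply: coeff_eq0 (psi_bas (rk j)) _ _ => x sx; move: rj; rewrite -sx /= inE eqxx addbT.
  by move/negbFE => ->; rewrite mul0r.
move: fj; rewrite /filled f negbK => ->.
apply: coeff_eq0 (opr_bas _ _) _ _ => x [_ /ffunP /(_ (rk j))].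
by rewrite !ffunE eqxx addn1.
Qed.

Let Y_coeff j u : filled j -> coeff v0 (Y j u) = 0.
Proof.
rewrite /Y => fj; have := v0_rk j; rewrite fj andbT.
case f: (fermi j) => rj.
  apply: coeff_eq0 (dpsi_bas (rk j)) _ _ => x sx; move: rj; rewrite -sx /= inE eqxx addbT.
  by move/negPf => ->; rewrite mul0r.
move: fj; rewrite /filled f => /negPf ->.
rewrite endFN coeffN; apply/eqP; rewrite oppr_eq0; apply/eqP.
apply: coeff_eq0 (opr_bas _ _) _ _ => x [_ /ffunP /(_ (rk j))].
by rewrite !ffunE eqxx addn1.
Qed.

(** A term [X (i, p) * Y (j, p)] of a raising operator survives on the vacuum only if [(j, p)] is
    filled and [(i, p)] is not. For even [i] and odd [j] this is what forces the exchange of bosons: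
    where the odd modes are fermions, the even modes of the same copy are bosons and must count as
    filled. *)
Let filled_mono (i j : I) p : (i < j)%N -> filled (j, p) -> filled (i, p).
Proof.
case: p => t k ij; rewrite /filled /fermi /=.
have := al_mono ij; have : par i -> par j by rewrite /par => /leq_trans -> //; exact: ltnW.
case: (par i) => [->//|_]; case: (par j); case: t => //=.
all: move=> /(_ erefl) aij kj; exact: leq_trans kj aij.
Qed.

Let XY_comm j k : j != k -> exists s : C, X j * Y k = s *: (Y k * X j).
Proof.
move=> jk; exists ((-1) ^+ (fermi k && fermi j)).
by rewrite YX eq_sym (negPf jk) addr0 scalerA -signr_addb addbb scale1r.
Qed.

Let XY_diag j : X j * Y j = (-1) ^+ (fermi j) *: (Y j * X j - 1).
Proof. by rewrite YX eqxx addrK andbb scalerA -signr_addb addbb scale1r. Qed.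

(** The eigenvalue of [X j * Y j] on the vacuum: a filled fermion counts 1, a filled boson, being
    exchanged, counts -1. *)
Let occupation j : C := if filled j then - (-1) ^+ (fermi j) else 0.

Let XY_diag_coeff j u : coeff v0 ((X j * Y j) u) = occupation j * coeff v0 u.
Proof.
rewrite /occupation; case: ifPn => fj; last first.
  by rewrite endFM X_coeff // mul0r.
rewrite XY_diag endFZl endFB endF1 endFM.
by rewrite coeffZ coeffB Y_coeff // sub0r mulrN mulNr.
Qed.

Let XY_diag_v0 j : (X j * Y j) (bas v0) = occupation j *: bas v0.
Proof.
rewrite /occupation; case: ifPn => fj; last first.
  by rewrite endFM Y_v0 // scale0r endF0.
rewrite XY_diag endFZl endFB endF1 endFM.
by rewrite X_v0 // endF0 sub0r scalerN scaleNr.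
Qed.

Let XY_raise (i j : I) : (i < j)%N -> osc X Y i j (bas v0) = 0.
Proof.
move=> ij; rewrite /osc endF_sum big1 // => p _.
have ijp : (i, p) != (j, p) by rewrite xpair_eqE -val_eqE (ltn_eqF ij).
have [fj|fj] := boolP (filled (j, p)); last by rewrite endFM Y_v0 // endF0.
have [s ->] := XY_comm ijp.
by rewrite endFZl endFM X_v0 ?endF0 ?scaler0 //; exact: filled_mono ij fj.
Qed.

Let XY_lower (i j : I) u : (j < i)%N -> coeff v0 (osc X Y i j u) = 0.
Proof.
move=> ji; rewrite /osc endF_sum (big_morph _ (coeffD v0) (coeff0 _ v0)) big1 // => p _.
have ijp : (i, p) != (j, p) by rewrite xpair_eqE -val_eqE (gtn_eqF ji).
have [fi|fi] := boolP (filled (i, p)); last by rewrite endFM X_coeff.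
have [s ->] := XY_comm ijp.
by rewrite endFZl endFM coeffZ Y_coeff ?mulr0 //; exact: filled_mono ji fi.
Qed.

Let weight i : C := (al i)%:R - (~~ par i)%:R * K%:R.

Let occupation_sum i : \sum_(p : P) occupation (i, p) = weight i.
Proof.
have S1 : \sum_(k < K) ((k < al i)%N%:R : C) = (al i)%:R.
  rewrite -[al i in RHS]card_ord -sumr_const (big_ord_widen _ (fun=> 1) (al_le i)).
  by rewrite [RHS]big_mkcond; apply: eq_bigr => k _; case: ifP.
rewrite -(pair_bigA _ (fun t k => occupation (i, (t, k)))) /= big_bool /weight.
rewrite /occupation /filled /fermi /=; case: (par i) => /=.
  rewrite big1_eq add0r mul0r subr0 -S1; apply: eq_bigr => k _.
  by case: ifP; rewrite ?expr1 ?opprK.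
rewrite mul1r -S1; congr (_ + _).
  by apply: eq_bigr => k _; case: ifP; rewrite ?expr1 ?opprK.
by rewrite sumr_const card_ord expr0 mulNrn.
Qed.

(** The functional is the vacuum expectation value. The left and right conditions come from the
    operators that kill the vacuum and from those that never produce it. *)
Lemma fock_hc_functional (U : algType C) (iota : {linear 'M[C]_(m + n) -> U}) :
  is_enveloping iota -> exists c, hc_functional iota weight c.
Proof.
move=> U_env; have [f f_rep fE] := osc_rep XX YY YX.
have [g gE _] := U_env.2 _ f f_rep.
have gM x y u : g (x * y) u = g x (g y u) by rewrite rmorphM endFM.
have g_osc i j : g (iota (delta_mx i j)) = osc X Y i j by rewrite gE fE.
exists (fun x => coeff v0 (g x (bas v0))); split.
- move=> a x y; have -> : g (a *: x + y) = a *: g x + g y by exact: linearP.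
  by rewrite endFD endFZl coeffD coeffZ.
- by rewrite rmorph1 coeff_bas eqxx.
- by move=> x i j ij; rewrite gM g_osc XY_raise // endF0 coeff0.
- by move=> x i j ij; rewrite gM g_osc XY_lower.
- move=> x i; rewrite gM g_osc /osc endF_sum.
  under eq_bigr do rewrite XY_diag_v0.
  by rewrite -scaler_suml occupation_sum endFZ coeffZ.
- move=> x i; rewrite gM g_osc /osc endF_sum (big_morph _ (coeffD v0) (coeff0 _ v0)).
  under eq_bigr do rewrite XY_diag_coeff.
  by rewrite -mulr_suml occupation_sum.
Qed.
End FockFunctional.

(** * Polynomials vanishing at ordered integral points *)

Section OrderedPoints.
Variables (C : numFieldType) (N : nat).

Lemma rmorph_mmap (k : nat) (R : nzRingType) (S T : comNzRingType)
    (g : {rmorphism S -> T}) (h : R -> S) (v : 'I_k -> S) (p : {mpoly R[k]}) :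
  g (mmap h v p) = mmap (g \o h) (g \o v) p.
Proof.
rewrite /mmap rmorph_sum; apply: eq_bigr => mu _ /=; rewrite rmorphM; congr (_ * _).
by rewrite /mmap1 rmorph_prod; apply: eq_bigr => i _; rewrite rmorphXn.
Qed.

Lemma poly_many_roots (R : idomainType) (q : {poly R}) (e : nat -> R) B :
  injective e -> (forall c, (B <= c)%N -> root q (e c)) -> q = 0.
Proof.
move=> e_inj rts; apply/eqP; apply: contraT => q0.
pose rs := [seq e c | c <- iota B (size q)].
have rs_roots : all (root q) rs.
  by apply/allP => _ /mapP[c cB ->]; apply: rts; move: cB; rewrite mem_iota => /andP[].
have rs_uniq : uniq rs by rewrite map_inj_uniq ?iota_uniq.
by have := max_poly_roots q0 rs_roots rs_uniq; rewrite size_map size_iota ltnn.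
Qed.

Variables (sigma : 'I_N -> nat) (r eps : 'I_N -> C).
Hypothesis sigma_inj : injective sigma.
Hypothesis eps_neq0 : forall i, eps i != 0.

Let monotone (ga : 'I_N -> nat) := forall i j, (sigma i <= sigma j)%N -> (ga i <= ga j)%N.

(* The coordinates are freed one at a time, the one with the largest value of
   [sigma] first: it takes infinitely many values once the others are fixed. *)
Lemma mpoly_ordered_eq0 (f : {mpoly C[N]}) :
  (forall ga, monotone ga -> f.@[fun i => r i + eps i * (ga i)%:R] = 0) -> f = 0.
Proof.
move=> f0.
pose pt (ga : 'I_N -> nat) i : {mpoly C[N]} := (r i + eps i * (ga i)%:R)%:MP.
(* Coordinates with [sigma i < k] are specialized, the others are still variables. *)
pose ev k ga := mmap (@mpolyC N C) (fun i => if (sigma i < k)%N then pt ga i else 'X_i) f.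
(* Downward induction on the threshold [k], with [k + d] above all values of [sigma]. *)
suff E d : forall k ga, (forall i, (sigma i < k + d)%N) -> monotone ga -> ev k ga = 0.
  have := E (\max_i sigma i).+1 0%N (fun=> 0%N) _ (fun _ _ _ => leqnn _).
  rewrite /ev => <- //; last by move=> i; rewrite ltnS leq_bigmax.
  rewrite -[LHS]comp_mpoly_id /comp_mpoly; congr (mmap _ _ _).
  by apply/funext => i; rewrite tnth_mktuple.
elim: d => [|d IH] k ga lt_sigma mga.
  have -> : ev k ga = (f.@[fun i => r i + eps i * (ga i)%:R])%:MP.
    rewrite /meval rmorph_mmap /ev; congr (mmap _ _ _).
    by apply/funext => i /=; rewrite -[k]addn0 lt_sigma.
  by rewrite f0 // mpolyC0.
have [[i0 si0]|no_i] := pselect (exists i, sigma i = k); last first.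
  rewrite -(IH k.+1 ga) // => [|i]; last by rewrite addSnnS.
  rewrite /ev; congr (mmap _ _ _); apply/funext => i; rewrite ltnS [in RHS]leq_eqVlt.
  by case: eqP => // si; case: no_i; exists i.
pose w i : {poly {mpoly C[N]}} :=
  if i == i0 then 'X else (if (sigma i < k)%N then pt ga i else 'X_i)%:P.
pose q := mmap (polyC \o @mpolyC N C) w f.
have qE x : q.[x] = mmap (@mpolyC N C)
    (fun i => if i == i0 then x else if (sigma i < k)%N then pt ga i else 'X_i) f.
  rewrite -/(horner_eval x q) rmorph_mmap; congr (mmap _ _ _); apply/funext => i /=.
    by rewrite /horner_eval hornerC.
  by rewrite /horner_eval /w; case: eqP => _; rewrite ?hornerX ?hornerC.
have q0 : q = 0.
  pose e c : {mpoly C[N]} := (r i0 + eps i0 * c%:R)%:MP.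
  apply: (@poly_many_roots _ q e (\max_i ga i)) => [c c'|c le_c].
    move=> /(congr1 (meval (fun=> 0))); rewrite !mevalC => /addrI.
    by move/(mulfI (eps_neq0 i0))/eqP; rewrite eqr_nat => /eqP.
  apply/rootP; rewrite qE.
  (* All coordinates from the threshold on get the common value [c], which keeps the point monotone
     once [c] is at least every [ga i]; those beyond the threshold do not enter [ev k.+1]. *)
  pose ga' i := if (sigma i < k)%N then ga i else c.
  have mga' : monotone ga'.
    move=> i j ij; rewrite /ga'.
    case: (ltnP (sigma i)) => si; case: (ltnP (sigma j)) => sj //.
    - exact: mga.
    - exact: leq_trans (leq_bigmax _) le_c.
    - by move: (leq_trans (leq_ltn_trans ij sj) si); rewrite ltnn.
  rewrite -(IH k.+1 ga' _ mga') => [|i]; last by rewrite addSnnS.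
  rewrite /ev; congr (mmap _ _ _); apply/funext => i.
  rewrite ltnS [(sigma i <= k)%N]leq_eqVlt -{2}si0 (inj_eq sigma_inj); case: eqP => [->|_] /=.
    by rewrite /pt /ga' si0 ltnn.
  by case: ifP => // lt; rewrite /pt /ga' lt.
transitivity q.['X_i0]; last by rewrite q0 horner0.
rewrite qE /ev; congr (mmap _ _ _); apply/funext => i.
by case: eqP => // ->; rewrite si0 ltnn.
Qed.
End OrderedPoints.

Lemma hc_functional_dense (C : numFieldType) (m n : nat) (U : algType C)
    (iota : {linear 'M[C]_(m + n) -> U}) (f : {mpoly C[m + n]}) :
  is_enveloping iota ->
  (forall lam c, hc_functional iota lam c -> f.@[fun i => lam i + rho C i] = 0) ->
  f = 0.
Proof.
move=> U_env f0.
(* The weights will be $-ga_i$ at unbarred and $ga_i$ at barred indices and must decrease within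
   each block. So [sigma] keeps the unbarred order, reverses the barred one and puts the barred
   block last. *)
pose sigma (i : 'I_(m + n)) := if par i then (m + (m + n) - i)%N else i.
pose eps (i : 'I_(m + n)) : C := (-1) ^+ ~~ par i.
apply: (@mpoly_ordered_eq0 C _ sigma (@rho C m n) eps).
- move=> i j; rewrite /sigma /par => ij; apply: ord_inj; move: ij.
  have := ltn_ord i; have := ltn_ord j.
  by case: (leqP m i); case: (leqP m j); lia.
- by move=> i; rewrite signr_eq0.
(* The number [K] of copies depends on the point; it cancels from the unbarred weights $(K - ga_i) -
   K$. *)
move=> ga mga; pose K := (\max_i ga i)%N.
have gaK i : (ga i <= K)%N by exact: leq_bigmax.
pose al i := if par i then ga i else (K - ga i)%N.
have al_le i : (al i <= K)%N by rewrite /al; case: par; rewrite ?leq_subr.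
have al_mono (i j : 'I_(m + n)) : (i < j)%N -> par i = par j -> (al j <= al i)%N.
  move=> ij; rewrite /al => pij; move: (mga i j) (mga j i).
  rewrite /sigma pij; have := ltn_ord j; case: (par j) => ltj mij mji.
    by apply: mji; lia.
  by apply: leq_sub2l; apply: mij; exact: ltnW.
have [c c_hc] := fock_hc_functional al_le al_mono U_env.
rewrite -(f0 _ _ c_hc); congr meval; apply/funext => i; rewrite addrC; congr (_ + _).
rewrite /eps /al; case: (par i); first by rewrite mul0r subr0 mul1r.
by rewrite natrB // mul1r expr1 mulN1r addrAC subrr add0r.
Qed.

(** * The generators of D' acting on monomials; degree and parity *)

Section DprimeOperators.
Variables (C : numFieldType) (m n : nat).
Local Notation mon := (mon m n).
Local Notation bas := (@bas C m n).
Local Notation End := (endF C m n).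
Local Notation D := (Dprime C m n).
Local Notation O := (zero_idx m n).

Variant up_spec : 'I_(m.+1 + n) -> Type :=
| UpZero : up_spec O
| UpEven (a : 'I_m) : up_spec (up (lshift n a))
| UpOdd (j : 'I_n) : up_spec (up (rshift m j)).

Lemma upP i : up_spec i.
Proof.
case: (unliftP ord0 i) => [k|] -> ; last exact: UpZero.
by case: (split_ordP (k : 'I_(m + n))) => j ->; [exact: UpEven|exact: UpOdd].
Qed.

Lemma split_zero : split O = inl ord0.
Proof.
by rewrite -[RHS](@unsplitK m.+1 n); congr split; exact: val_inj.
Qed.
Lemma split_even (a : 'I_m) : split (up (lshift n a)) = inl (fintype.lift ord0 a) :> 'I_m.+1 + 'I_n.
Proof.
by rewrite -[RHS](@unsplitK m.+1 n); congr split; exact: val_inj.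
Qed.
Lemma split_odd (j : 'I_n) : split (up (rshift m j)) = inr j :> 'I_m.+1 + 'I_n.
Proof.
by rewrite -[RHS](@unsplitK m.+1 n); congr split; exact: val_inj.
Qed.

Lemma t_zero k : t_t0pow O k = t0pow m n (1 + k).
Proof. by rewrite /t_t0pow split_zero unlift_none. Qed.
Lemma t_even (a : 'I_m) k :
  t_t0pow (up (lshift n a)) k = (k, [ffun b => (b == a : nat)], set0).
Proof. by rewrite /t_t0pow split_even liftK. Qed.
Lemma t_odd (j : 'I_n) k : t_t0pow (up (rshift m j)) k = (k, [ffun=> 0%N], [set j]).
Proof. by rewrite /t_t0pow split_odd. Qed.

Lemma pd_bas i (x : mon) : pd C i (bas x) = mon_deriv C i x.
Proof. exact: linext_bas. Qed.
Lemma lmul_bas (x y : mon) : lmul C x (bas y) = mon_mul C x y.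
Proof. exact: linext_bas. Qed.

Lemma deriv_zero (x : mon) : mon_deriv C O x = x.1.1%:~R *: bas (x.1.1 - 1, x.1.2, x.2).
Proof. by rewrite /mon_deriv split_zero unlift_none. Qed.
Lemma deriv_even (a : 'I_m) (x : mon) : mon_deriv C (up (lshift n a)) x =
  (x.1.2 a)%:R *: bas (x.1.1, [ffun b => (x.1.2 b - (b == a))%N], x.2).
Proof. by rewrite /mon_deriv split_even liftK. Qed.
Lemma deriv_odd (j : 'I_n) (x : mon) : mon_deriv C (up (rshift m j)) x =
  if j \in x.2 then (-1) ^+ #|[set s in x.2 | (s < j)%N]| *: bas (x.1, x.2 :\ j) else 0.
Proof. by rewrite /mon_deriv split_odd. Qed.

Lemma inversions0 (S : {set 'I_n}) : inversions set0 S = 0%N.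
Proof. by apply/eqP; rewrite cards_eq0; apply/eqP/setP => p; rewrite !inE. Qed.

Lemma mul_even k (f : {ffun 'I_m -> nat}) (x : mon) : mon_mul C (k, f, set0) x =
  bas (k + x.1.1, [ffun i => (f i + x.1.2 i)%N], x.2).
Proof.
by rewrite /mon_mul -setI_eq0 set0I eqxx inversions0 scale1r /= set0U.
Qed.

Lemma mul_odd k (j : 'I_n) (x : mon) : mon_mul C (k, [ffun=> 0%N], [set j]) x =
  if j \in x.2 then 0 else
  (-1) ^+ #|[set s in x.2 | (s < j)%N]| *: bas (k + x.1.1, x.1.2, j |: x.2).
Proof.
rewrite /mon_mul disjoints1 /=; case: (j \in x.2) => //=.
congr (_ ^+ _ *: bas (_, _, _)); last by apply/ffunP => i; rewrite !ffunE.
have pair_inj : injective (pair j : 'I_n -> 'I_n * 'I_n) by move=> s s' [].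
rewrite -(card_imset _ pair_inj).
apply: eq_card => -[i s]; rewrite !inE /=; apply/idP/imsetP.
  by move=> /andP[/andP[/eqP -> sx] sj]; exists s => //; rewrite inE sx.
by move=> [s']; rewrite inE => /andP[sx sj] [-> ->]; rewrite eqxx sx.
Qed.

Definition mdeg (x : mon) : int := x.1.1 + (\sum_i x.1.2 i)%:Z + #|x.2|%:Z.

Lemma t0_bas (x : mon) : op_t0 C m n (bas x) = bas (1 + x.1.1, x.1.2, x.2).
Proof.
rewrite op_t0E lmul_bas mul_even; congr (bas (_, _, _)).
by apply/ffunP => i; rewrite !ffunE.
Qed.

Lemma t_bas i (x : mon) : op_t C i (bas x) = mon_mul C (t_t0pow i 0) x.
Proof. exact: lmul_bas. Qed.

Lemma tp_zero (x : mon) : op_t C O (pd C O (bas x)) = x.1.1%:~R *: bas x.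
Proof.
rewrite pd_bas deriv_zero endFZ t_bas t_zero mul_even; congr (_ *: _).
case: x => [[k f] S] /=; congr (bas (_, _, _)); first by rewrite addr0 addrC subrK.
by apply/ffunP => i; rewrite !ffunE.
Qed.

Lemma tp_even (a : 'I_m) (x : mon) :
  op_t C (up (lshift n a)) (pd C (up (lshift n a)) (bas x)) = (x.1.2 a)%:R *: bas x.
Proof.
case: x => [[k f] S]; rewrite pd_bas deriv_even endFZ t_bas t_even mul_even /=.
case: (posnP (f a)) => [->|fa]; first by rewrite !scale0r.
congr (_ *: bas (_, _, _)); first by rewrite add0r.
apply/ffunP => i; rewrite !ffunE; case: eqVneq => [->|_]; first by rewrite subnKC.
by rewrite subn0.
Qed.

Lemma tp_odd (j : 'I_n) (x : mon) :
  op_t C (up (rshift m j)) (pd C (up (rshift m j)) (bas x)) = (j \in x.2)%:R *: bas x.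
Proof.
case: x => [[k f] S]; rewrite pd_bas deriv_odd [(_, S).2]/=; case: ifP => jS; last by rewrite endF0 scale0r.
rewrite endFZ t_bas t_odd mul_odd !inE eqxx /= scalerA.
have -> : #|[set s in S :\ j | (s < j)%N]| = #|[set s in S | (s < j)%N]|.
  apply: eq_card => s; rewrite !inE; case: eqVneq => [->|_] //=.
  by rewrite ltnn andbF.
by rewrite -expr2 sqrr_sign add0r setD1K.
Qed.

Lemma Euler_bas (x : mon) : Euler C m n (bas x) = (mdeg x)%:~R *: bas x.
Proof.
have -> : dop (Euler C m n) = \sum_i op_t C i * pd C i.
  exact: (big_morph (@dop C m n) (fun _ _ => erefl) erefl).
rewrite endF_sum (big_ord_recl (m + n)) endFM -/(zero_idx m n) tp_zero.
rewrite (eq_bigr (fun i => op_t C (up i) (pd C (up i) (bas x)))) //.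
rewrite big_split_ord (eq_bigr _ (fun a _ => tp_even a x)) (eq_bigr _ (fun j _ => tp_odd j x)).
rewrite -!scaler_suml /= -!scalerDl; congr (_ *: _); rewrite /mdeg addrA !rmorphD /=.
rewrite -!natr_sum; congr (_ + _%:R).
by rewrite -sum1_card [RHS]big_mkcond; apply: eq_bigr => i _; case: (i \in _).
Qed.

Definition shift_t0 (u : int) (x : mon) : mon := (u + x.1.1, x.1.2, x.2).

(** One target monomial and one polynomial serve all shifts [u] of the power of $t_0$, the source of
    polynomiality in [u]. The degree and parity of the target matter only when the coefficient is
    nonzero. *)
Definition monomial_op b (g : End) : Prop := forall x, exists y (q : {poly C}),
  (q != 0 -> mdeg y = mdeg x /\ odd #|y.2| = b (+) odd #|x.2|) /\
  forall u, g (bas (shift_t0 u x)) = q.[u%:~R] *: bas (shift_t0 u y).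

Lemma sum_incr (f g : 'I_m -> nat) a :
  (forall i, g i = (f i + (i == a))%N) -> (\sum_i g i = (\sum_i f i).+1)%N.
Proof.
move=> gE; rewrite (eq_bigr _ (fun i _ => gE i)) big_split -addn1; congr (_ + _)%N.
by rewrite (bigD1 a) //= eqxx big1 // => i /negPf ->.
Qed.

Lemma monomial_op_t i : exists b, monomial_op b (op_t_over_t0 C i).
Proof.
case: (upP i) => [|a|j].
- exists false => x; exists x, 1; split=> // u.
  rewrite hornerC scale1r lmul_bas t_zero mul_even; congr (bas (_, _, _)).
  + by rewrite subrr add0r.
  + by apply/ffunP => b; rewrite !ffunE.
- exists false => -[[k f] S].
  exists (k - 1, [ffun i => ((i == a) + f i)%N], S), 1; split=> [_|u].
    split=> //; rewrite /mdeg /= (@sum_incr f _ a) => [|b]; last by rewrite ffunE addnC.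
    by rewrite -addn1 PoszD addrA addrAC addrNK.
  rewrite hornerC scale1r lmul_bas t_even mul_even; congr (bas (_, _, _)).
  + by rewrite /= addrCA [k - 1]addrC addrCA.
  + by apply/ffunP => b; rewrite !ffunE.
- exists true => -[[k f] S].
  exists (k - 1, f, j |: S), (if j \in S then 0 else ((-1) ^+ #|[set s in S | (s < j)%N]|)%:P).
  split=> [|u].
    case: ifP => jS; rewrite ?eqxx // => _.
    have int_eq (p q r : int) : p - 1 + q + (r + 1) = p + q + r by lia.
    by rewrite /mdeg /= cardsU1 jS add1n -[in X in X = _]addn1 PoszD; split; first exact: int_eq.
  rewrite lmul_bas t_odd mul_odd /=; case: ifP => jS; first by rewrite horner0 scale0r.
  rewrite hornerC; congr (_ *: bas (_, _, _)).
  by rewrite /= addrCA [k - 1]addrC addrCA.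
Qed.

Lemma monomial_op_p i : exists b, monomial_op b (op_t0 C m n * pd C i).
Proof.
case: (upP i) => [|a|j].
(* The eigenvalue of $t_0\partial_0$ is the exponent of $t_0$; among the generators, only this one
   has a coefficient depending on [u]. *)
- exists false => x; exists x, ('X + (x.1.1)%:~R%:P); split=> // u.
  rewrite endFM pd_bas deriv_zero endFZ t0_bas hornerD hornerX hornerC -rmorphD /=.
  by congr (_ *: bas (_, _, _)); rewrite addrC subrK.
- exists false => -[[k f] S].
  exists (1 + k, [ffun i => (f i - (i == a))%N], S), (f a)%:R%:P; split=> [|u].
    rewrite polyC_eq0 pnatr_eq0 => fa; split=> //; rewrite /mdeg /=.
    rewrite [X in _ = _ + X%:Z + _](@sum_incr (fun i => f i - (i == a))%N _ a) => [|b].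
      under eq_bigr do rewrite ffunE; by rewrite -addn1 PoszD addrA addrAC [1 + k]addrC.
    by case: eqVneq => [->|_]; rewrite ?subn0 ?addn0 // subnK // lt0n.
  rewrite endFM pd_bas deriv_even endFZ t0_bas hornerC; congr (_ *: bas (_, _, _)).
  by rewrite /= addrCA.
- exists true => -[[k f] S].
  exists (1 + k, f, S :\ j), (if j \in S then ((-1) ^+ #|[set s in S | (s < j)%N]|)%:P else 0).
  split=> [|u].
    case: ifP => jS; rewrite ?eqxx // => _.
    have int_eq (p q r : int) : 1 + p + q + r = p + q + (r + 1) by lia.
    rewrite /mdeg /= [#|S|](cardsD1 j S) jS add1n -[in X in _ = X]addn1 PoszD.
    by split; [exact: int_eq|rewrite /= negbK].
  rewrite endFM pd_bas deriv_odd [(_, S).2]/=; case: ifP => jS.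
    rewrite endFZ t0_bas hornerC; congr (_ *: bas (_, _, _)).
    by rewrite /= addrCA.
  by rewrite endF0 horner0 scale0r.
Qed.

Lemma fock_expand (f : fockT C m n) : f = \sum_(x <- dom f) coeff x f *: bas x.
Proof.
rewrite -{1}[f]freeg_sumE; apply: eq_bigr => x _.
by apply/eqP/freeg_eqP => y; rewrite coeffZ !coeffU mul1r.
Qed.

Lemma shift_t00 x : shift_t0 0 x = x.
Proof. by case: x => [[k f] S]; rewrite /shift_t0 add0r. Qed.

Lemma monomial_op_homog b (g : End) : monomial_op b g ->
  forall c f, F_homog c f -> F_homog (b (+) c) (g f).
Proof.
move=> gm c f fc x; rewrite [f]fock_expand.
have -> : g (\sum_(z <- dom f) coeff z f *: bas z) = \sum_(z <- dom f) coeff z f *: g (bas z).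
  elim: (dom f) => [|z r IH]; first by rewrite !big_nil endF0.
  by rewrite !big_cons efunP IH.
rewrite (big_morph _ (coeffD x) (coeff0 _ x)).
elim: (dom f) => [|z r IH]; first by rewrite big_nil eqxx.
rewrite big_cons coeffZ; have [zf0|zf] := eqVneq (coeff z f) 0.
  by rewrite zf0 mul0r add0r.
have [y [q [yq gE]]] := gm z; move: (gE 0); rewrite !shift_t00 => ->.
rewrite coeffZ coeff_bas; have [xy|_] := eqVneq x y; last by rewrite !mulr0 add0r.
subst x; have [->|q0 _] := eqVneq q 0; first by rewrite horner0 !(mul0r, mulr0) add0r.
by have [_ ->] := yq q0; rewrite (fc _ zf).
Qed.

Lemma monomial_op_Euler b (g : End) : monomial_op b g ->
  dop (Euler C m n) * g = g * dop (Euler C m n).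
Proof.
move=> gm; apply: endF_bas_ext => x; have [y [q [yq gE]]] := gm x.
move: (gE 0); rewrite !shift_t00 !endFM Euler_bas endFZ => ->.
rewrite !endFZ Euler_bas !scalerA mulrC.
have [->|q0] := eqVneq q 0; first by rewrite horner0 !(mul0r, mulr0).
by have [-> _] := yq q0.
Qed.

Lemma Dgen_monomial (d : End) : Dgen d -> exists b, monomial_op b d.
Proof. by case=> i [] ->; [exact: monomial_op_t|exact: monomial_op_p]. Qed.

Lemma Dprime_generated (d : D) : generated (@Dgen C m n) d.
Proof. exact: (asboolP _ (dopP d)). Qed.

Lemma Euler_central (d : D) : Euler C m n * d = d * Euler C m n.
Proof.
apply: val_inj => /=.
change (dop (Euler C m n) * dop d = dop d * dop (Euler C m n)).
elim: (Dprime_generated d) => {d} [d /Dgen_monomial [b]||a x y _ IHx _ IHy|x y _ IHx _ IHy].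
- exact: monomial_op_Euler.
- by rewrite mulr1 mul1r.
- by rewrite mulrDr mulrDl -scalerAr -scalerAl IHx IHy.
- by rewrite mulrA IHx -!mulrA IHy.
Qed.

Lemma F_homog_lin b a (f g : fockT C m n) :
  F_homog b f -> F_homog b g -> F_homog b (a *: f + g).
Proof.
move=> fb gb x; rewrite coeffD coeffZ.
have [->|/fb //] := eqVneq (coeff x f) 0; rewrite mulr0 add0r; exact: gb.
Qed.

Lemma F_homog0 b : F_homog b (0 : fockT C m n).
Proof. by move=> x; rewrite coeff0 eqxx. Qed.

Lemma D_homog_gen (i : 'I_(m.+1 + n)) : exists b, D_homog b (D_t C i).
Proof. by have [b /monomial_op_homog h] := monomial_op_t i; exists b. Qed.

Lemma D_homog_p (i : 'I_(m.+1 + n)) : exists b, D_homog b (D_p C i).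
Proof. by have [b /monomial_op_homog h] := monomial_op_p i; exists b. Qed.

Lemma D_homogM b c (d d' : D) : D_homog b d -> D_homog c d' -> D_homog (b (+) c) (d * d').
Proof. by move=> hd hd' e f fe; rewrite -addbA; apply: hd; exact: hd'. Qed.

Lemma D_homog1 : D_homog false (1 : D).
Proof. by move=> e f. Qed.

Lemma D_tpE (i j : 'I_(m.+1 + n)) : D_tp C i j = D_t C i * D_p C j :> D.
Proof.
apply: val_inj; change (op_t C i * pd C j = op_t_over_t0 C i * (op_t0 C m n * pd C j)).
by rewrite mulrA op_t_over_t0_mul.
Qed.

Lemma D_homog_tp (i j : 'I_(m.+1 + n)) : exists b, D_homog b (D_tp C i j).
Proof.
have [b hb] := D_homog_gen i; have [c hc] := D_homog_p j.
by exists (b (+) c); rewrite D_tpE; exact: D_homogM.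
Qed.

Lemma D_homog_diag (d : D) (k : mon -> C) :
  (forall x, d (bas x) = k x *: bas x) -> D_homog false d.
Proof.
move=> dE c f fc x; rewrite addFb => nz; apply: fc; apply: contraNneq nz => fx.
suff -> : coeff x (d f) = k x * coeff x f by rewrite fx mulr0.
move: f {fx}; apply: fock_scalar_ext.
- by move=> a u v; rewrite efunP coeffD coeffZ.
- by move=> a u v; rewrite coeffD coeffZ mulrDr mulrCA.
move=> y; rewrite dE coeffZ coeff_bas.
by have [->|] := eqVneq x y; rewrite ?mulr0.
Qed.

Lemma D_homog_Euler : D_homog false (Euler C m n).
Proof. exact: D_homog_diag Euler_bas. Qed.

Lemma D_split (d : D) : exists d0 d1,
  [/\ D_homog false d0, D_homog true d1 & d = d0 + d1].
Proof.
(* Restated for underlying operators, since the induction over [generated] runs in [endF], outside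
   the subalgebra type. *)
suff [d0 [d1 [h0 h1 dE]]] : exists d0 d1 : D,
    [/\ D_homog false d0, D_homog true d1 & dop d = dop d0 + dop d1].
  by exists d0, d1; split=> //; exact: val_inj.
have homogD b (d1 d2 : D) a : D_homog b d1 -> D_homog b d2 -> D_homog b (a *: d1 + d2).
  by move=> h1 h2 c f fc; apply: F_homog_lin; [exact: h1|exact: h2].
have homog0 b : D_homog b (0 : D) by move=> c f _; exact: F_homog0.
elim: (Dprime_generated d) => {d} [d [i di]||a x y _ IHx _ IHy|x y _ IHx _ IHy].
- have [b [d' [hd' ->]]] : exists b (d' : D), D_homog b d' /\ d = d'.
    case: di => ->; last by have [b hb] := D_homog_p i; exists b, (D_p C i).
    by have [b hb] := D_homog_gen i; exists b, (D_t C i).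
  case: b hd' => hd'; [exists 0, d'|exists d', 0]; split=> //.
    by rewrite -[LHS]add0r.
  by rewrite -[LHS]addr0.
- by exists 1, 0; split=> //; rewrite -[LHS]addr0.
- have [x0 [x1 [h0 h1 ->]]] := IHx; have [y0 [y1 [k0 k1 ->]]] := IHy.
  exists (a *: x0 + y0), (a *: x1 + y1); split; try exact: homogD.
  by rewrite scalerDr addrACA.
- have [x0 [x1 [h0 h1 ->]]] := IHx; have [y0 [y1 [k0 k1 ->]]] := IHy.
  exists (1 *: (x0 * y0) + x1 * y1), (1 *: (x0 * y1) + x1 * y0); split.
  + by apply: homogD; [exact: (D_homogM h0 k0)|exact: (D_homogM h1 k1)].
  + by apply: homogD; [exact: (D_homogM h0 k1)|exact: (D_homogM h1 k0)].
  + have E : (x0 + x1) * (y0 + y1)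
        = (1 *: (x0 * y0) + x1 * y1) + (1 *: (x0 * y1) + x1 * y0).
      by rewrite !scale1r mulrDl !mulrDr [RHS]addrACA [x1 * y1 + _]addrC.
    exact: (congr1 (@dop C m n) E).
Qed.

End DprimeOperators.

(** * Matrix entries of D' and the powers of $t_0$ *)

Section VacuumCoefficients.
Variables (C : numFieldType) (m n : nat).
Local Notation mon := (mon m n).
Local Notation bas := (@bas C m n).
Local Notation D := (Dprime C m n).
Local Notation O := (zero_idx m n).
Local Notation t0 := (t0pow m n).

Definition ent (x y : mon) (d : D) : C := coeff x (d (bas y)).

Lemma ent_lin x y a (d d' : D) : ent x y (a *: d + d') = a * ent x y d + ent x y d'.
Proof.
have -> : ent x y (a *: d + d') = coeff x (a *: d (bas y) + d' (bas y)) by [].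
by rewrite coeffD coeffZ.
Qed.

Lemma ent1 x y : ent x y 1 = (x == y)%:R.
Proof. exact: coeff_bas. Qed.

Lemma ent_eq (d d' : D) : (forall x y, ent x y d = ent x y d') -> d = d'.
Proof.
move=> E; apply: val_inj; apply: endF_bas_ext => y.
by apply/eqP/freeg_eqP => x; exact: E.
Qed.

Lemma shift_t0pow u k : shift_t0 u (t0 k) = t0 (u + k).
Proof. by []. Qed.

(** The list of targets and polynomials is independent of [u]; composing operators multiplies the
    polynomials. *)
Lemma Dprime_poly (d : D) x : exists s : seq (mon * {poly C}),
  forall u, d (bas (shift_t0 u x)) = \sum_(p <- s) p.2.[u%:~R] *: bas (shift_t0 u p.1).
Proof.
elim: (Dprime_generated d) x => {d} [d /Dgen_monomial [b dm]||a d d' _ IH _ IH'|d d' _ IH _ IH'] x.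
- have [y [q [_ dE]]] := dm x; exists [:: (y, q)] => u.
  by rewrite big_seq1 dE.
- by exists [:: (x, 1)] => u; rewrite big_seq1 hornerC scale1r.
- have [s sE] := IH x; have [s' s'E] := IH' x.
  exists ([seq (p.1, a *: p.2) | p <- s] ++ s') => u.
  rewrite big_cat big_map endFD endFZl sE s'E scaler_sumr; congr (_ + _).
  by apply: eq_bigr => p _; rewrite hornerZ scalerA.
- have [s sE] := IH' x.
  suff [s' s'E] : exists s' : seq (mon * {poly C}), forall u : int,
      d (\sum_(p <- s) p.2.[u%:~R] *: bas (shift_t0 u p.1)) =
      \sum_(p <- s') p.2.[u%:~R] *: bas (shift_t0 u p.1).
    by exists s' => u; rewrite endFM sE s'E.
  elim: s {sE} => [|[y q] s [s' s'E]]; first by exists [::] => u; rewrite !big_nil endF0.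
  have [r rE] := IH y; exists ([seq (p.1, q * p.2) | p <- r] ++ s') => u.
  rewrite big_cons efunP s'E rE big_cat big_map scaler_sumr; congr (_ + _).
  by apply: eq_bigr => p _; rewrite hornerM scalerA.
Qed.

Lemma vacuum_poly (d : D) : exists q : {poly C},
  forall u, ent (t0 u) (t0 u) d = q.[u%:~R].
Proof.
have [s sE] := Dprime_poly d (t0 0).
exists (\sum_(p <- s) (p.1 == t0 0)%:R *: p.2) => u; rewrite /ent.
have -> : t0 u = shift_t0 u (t0 0) by rewrite shift_t0pow addr0.
rewrite sE (big_morph _ (coeffD _) (coeff0 _ _)) horner_sum; apply: eq_bigr => p _.
rewrite coeffZ coeff_bas hornerZ mulrC; congr (_%:R * _).
congr nat_of_bool; apply/eqP/eqP => [[/addrI k f S]|->] //.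
by case: p.1 k f S => [[k f] S] /= <- <- <-.
Qed.

Lemma ent_odd (d : D) u : D_homog true d -> ent (t0 u) (t0 u) d = 0.
Proof.
move=> hd; apply: contrapT => /eqP nz.
have vac : F_homog false (bas (t0 u)).
  by move=> x; rewrite coeff_bas; have [->|] := eqVneq x (t0 u); rewrite ?eqxx //= cards0.
by have := hd _ _ vac (t0 u) nz; rewrite cards0.
Qed.

Lemma ent_Euler (d : D) u i : ent (t0 u) (t0 u) (d * Euler C m n ^+ i) =
  u%:~R ^+ i * ent (t0 u) (t0 u) d.
Proof.
elim: i d => [|i IH] d; first by rewrite !expr0 mulr1 mul1r.
rewrite exprS mulrA IH exprSr -mulrA; congr (_ * _).
rewrite /ent [LHS](_ : _ = coeff (t0 u) (d (Euler C m n (bas (t0 u))))) //.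
rewrite Euler_bas endFZ coeffZ; congr (_%:~R * _).
by rewrite /mdeg /= cards0 addr0 big1 ?addr0 // => a _; rewrite ffunE.
Qed.

(** A multiple of $t_i$, $i \in I$, contains no pure power of $t_0$. With [pd_vacuum] on the other
    side, this removes the D' part of the images of the lowering and raising operators. *)
Lemma lmul_vacuum (i : 'I_(m + n)) k u f : coeff (t0 u) (lmul C (t_t0pow (up i) k) f) = 0.
Proof.
apply: (fock_scalar_ext (F := fun f => coeff (t0 u) (lmul C (t_t0pow (up i) k) f))
  (G := fun=> 0)) => [a v w|a v w|y].
- by rewrite efunP coeffD coeffZ.
- by rewrite mulr0 addr0.
rewrite lmul_bas; case: (split_ordP i) => j ->.
  rewrite t_even mul_even coeff_bas; case: eqVneq => // -[_ /ffunP/(_ j)].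
  by rewrite !ffunE eqxx add1n.
rewrite t_odd mul_odd; case: ifP => _; first by rewrite coeff0.
rewrite coeffZ coeff_bas; case: eqVneq; rewrite ?mulr0 // => -[_ _ /setP/(_ j)].
by rewrite !inE eqxx.
Qed.

Lemma ent_t_left i (d : D) u x : ent (t0 u) x (D_t C (up i) * d) = 0.
Proof. exact: lmul_vacuum. Qed.

Lemma ent_tp_left i j (d : D) u x : ent (t0 u) x (D_tp C (up i) j * d) = 0.
Proof. exact: lmul_vacuum. Qed.

Lemma pd_vacuum (i : 'I_(m + n)) u : pd C (up i) (bas (t0 u)) = 0.
Proof.
rewrite pd_bas; case: (split_ordP i) => j ->.
  by rewrite deriv_even /= ffunE scale0r.
by rewrite deriv_odd inE.
Qed.

Lemma ent_p_right i (d : D) u x : ent x (t0 u) (d * D_p C (up i)) = 0.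
Proof.
rewrite [LHS](_ : _ = coeff x (d (op_t0 C m n (pd C (up i) (bas (t0 u)))))) //.
by rewrite pd_vacuum !endF0 coeff0.
Qed.

Lemma ent_tp_right i j (d : D) u x : ent x (t0 u) (d * D_tp C i (up j)) = 0.
Proof.
rewrite [LHS](_ : _ = coeff x (d (op_t C i (pd C (up j) (bas (t0 u)))))) //.
by rewrite pd_vacuum !endF0 coeff0.
Qed.

Lemma p_zero_bas x : D_p C O (bas x) = x.1.1%:~R *: bas x.
Proof.
rewrite [LHS](_ : _ = op_t0 C m n (pd C O (bas x))) //.
rewrite pd_bas deriv_zero endFZ t0_bas; congr (_ *: bas _).
by case: x => [[k f] S] /=; rewrite addrC subrK.
Qed.

Lemma D_homog_p_zero : D_homog false (D_p C O).
Proof. exact: D_homog_diag p_zero_bas. Qed.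

Lemma ent_p_zero_right x y (d : D) : ent x y (d * D_p C O) = y.1.1%:~R * ent x y d.
Proof.
rewrite /ent [LHS](_ : _ = coeff x (d (D_p C O (bas y)))) //.
by rewrite p_zero_bas endFZ coeffZ.
Qed.

Lemma ent_p_zero_left x y (d : D) : ent x y (D_p C O * d) = x.1.1%:~R * ent x y d.
Proof.
rewrite /ent [LHS](_ : _ = coeff x (D_p C O (d (bas y)))) //.
move: (dop d (bas y)); apply: fock_scalar_ext => [a u v|a u v|z].
- by rewrite efunP coeffD coeffZ.
- by rewrite coeffD coeffZ mulrDr mulrCA.
rewrite p_zero_bas coeffZ coeff_bas.
by have [->|] := eqVneq x z; rewrite ?mulr0.
Qed.

Definition occurs (i : 'I_(m + n)) (x : mon) : bool :=
  match split i with inl a => (0 < x.1.2 a)%N | inr j => j \in x.2 end.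

(** The monomial occurring in $t_0\partial_i x$, hence the additional factor $t_0$. *)
Definition remove (i : 'I_(m + n)) (x : mon) : mon :=
  match split i with
  | inl a => (1 + x.1.1, [ffun b => (x.1.2 b - (b == a))%N], x.2)
  | inr j => (1 + x.1.1, x.1.2, x.2 :\ j)
  end.

Definition height (x : mon) : nat := (\sum_a x.1.2 a + #|x.2|)%N.

Lemma remove_inj i x y : occurs i x -> occurs i y -> remove i x = remove i y -> x = y.
Proof.
case: x y => [[k f] S] [[l g] T]; rewrite /occurs /remove; case: split => j /= xj yj.
  move=> [/addrI -> fg ->]; congr (_, _, _); apply/ffunP => a.
  move/ffunP/(_ a): fg; rewrite !ffunE; case: eqVneq => [->|_]; last by rewrite !subn0.
  by move=> E; rewrite -(subnK xj) -(subnK yj) E.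
by move=> [/addrI -> -> E]; rewrite -(setD1K xj) -(setD1K yj) E.
Qed.

Lemma height_remove i x : occurs i x -> (height (remove i x) < height x)%N.
Proof.
case: x => [[k f] S]; rewrite /occurs /remove /height; case: split => j /= xj; last first.
  by rewrite ltn_add2l [X in (_ < X)%N](cardsD1 j S) xj.
rewrite ltn_add2r (bigD1 j) //= [X in (_ < X)%N](bigD1 j) //= ffunE eqxx subn1.
rewrite -(prednK xj) addSn ltnS leq_add2l; apply: leq_sum => a _.
by rewrite ffunE leq_subr.
Qed.

Lemma no_occurs x : (forall i, ~~ occurs i x) -> x = t0 x.1.1.
Proof.
case: x => [[k f] S] no; congr (_, _, _).
  apply/ffunP => a; rewrite ffunE; have := no (lshift n a).
  by rewrite /occurs -[lshift n a]/(unsplit (inl a)) unsplitK -eqn0Ngt => /eqP.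
apply/setP => j; rewrite inE; have := no (rshift m j).
by rewrite /occurs -[rshift m j]/(unsplit (inr j)) unsplitK => /negPf.
Qed.

Lemma p_bas i : exists2 k : mon -> C, (forall x, (k x != 0) = occurs i x)
  & forall x, D_p C (up i) (bas x) = k x *: bas (remove i x).
Proof.
case: (split_ordP i) => j ->.
  exists (fun x : mon => (x.1.2 j)%:R) => x.
    by rewrite /occurs -[lshift n j]/(unsplit (inl j)) unsplitK pnatr_eq0 lt0n.
  rewrite [LHS](_ : _ = op_t0 C m n (pd C (up (lshift n j)) (bas x))) //.
  rewrite pd_bas deriv_even endFZ t0_bas /remove.
  by rewrite -[lshift n j]/(unsplit (inl j)) unsplitK.
exists (fun x : mon => if j \in x.2 then (-1) ^+ #|[set s in x.2 | (s < j)%N]| else 0) => x.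
  rewrite /occurs -[rshift m j]/(unsplit (inr j)) unsplitK.
  by case: ifP; rewrite ?eqxx // signr_eq0.
rewrite [LHS](_ : _ = op_t0 C m n (pd C (up (rshift m j)) (bas x))) //.
rewrite pd_bas deriv_odd /remove -[rshift m j in RHS]/(unsplit (inr j)) unsplitK.
by case: ifP => _; rewrite ?endF0 ?scale0r // endFZ t0_bas.
Qed.

(** The row formula rests on [remove_inj]: among the monomials in which [i] occurs, only [x] is sent
    to [remove i x], and the other monomials have coefficient 0. *)
Lemma ent_p_occurs i : exists2 k : mon -> C, (forall x, (k x != 0) = occurs i x) &
  (forall x y (d : D), occurs i x -> ent (remove i x) y (D_p C (up i) * d) = k x * ent x y d)
  /\ forall x y (d : D), ent x y (d * D_p C (up i)) = k y * ent x (remove i y) d.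
Proof.
have [k k0 kE] := p_bas i; exists k => //; split=> x y d; last first.
  rewrite /ent [LHS](_ : _ = coeff x (d (D_p C (up i) (bas y)))) //.
  by rewrite kE endFZ coeffZ.
move=> xi; rewrite /ent [LHS](_ : _ = coeff (remove i x) (D_p C (up i) (d (bas y)))) //.
move: (dop d (bas y)); apply: fock_scalar_ext => [a u v|a u v|z].
- by rewrite efunP coeffD coeffZ.
- by rewrite coeffD coeffZ mulrDr mulrCA.
rewrite kE coeffZ !coeff_bas; have [->|xz] := eqVneq x z; first by rewrite eqxx.
have [zi|/negPf] := boolP (occurs i z); last first.
  by rewrite -k0 => /negbFE/eqP ->; rewrite mul0r mulr0.
case: eqVneq => [/(remove_inj xi zi)/eqP|_]; rewrite ?mulr0 //.
by rewrite (negPf xz).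
Qed.

Lemma ent_Euler_left x y (d : D) : ent x y (Euler C m n * d) = (mdeg x)%:~R * ent x y d.
Proof.
rewrite /ent [LHS](_ : _ = coeff x (Euler C m n (d (bas y)))) //.
move: (dop d (bas y)); apply: fock_scalar_ext => [a u v|a u v|z].
- by rewrite efunP coeffD coeffZ.
- by rewrite coeffD coeffZ mulrDr mulrCA.
rewrite Euler_bas coeffZ coeff_bas.
by have [->|] := eqVneq x z; rewrite ?mulr0.
Qed.

Lemma ent_Euler_right x y (d : D) : ent x y (d * Euler C m n) = (mdeg y)%:~R * ent x y d.
Proof.
rewrite /ent [LHS](_ : _ = coeff x (d (Euler C m n (bas y)))) //.
by rewrite Euler_bas endFZ coeffZ.
Qed.

Lemma mdeg_height x : mdeg x = x.1.1 + (height x)%:Z.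
Proof. by rewrite /mdeg /height PoszD addrA. Qed.

Lemma height_eq0 x : height x = 0%N -> x = t0 x.1.1.
Proof.
move=> hx; apply: no_occurs => i; apply/negP => /height_remove.
by rewrite hx.
Qed.
End VacuumCoefficients.

(** Evaluation at $0, \dots, N-1$ is an invertible Vandermonde matrix; its inverse isolates each
    vector coefficient. *)
Lemma powers_independent (C : numFieldType) (V : lmodType C) N (v : nat -> V) :
  (forall u : nat, \sum_(i < N) (u%:R : C) ^+ i *: v i = 0) ->
  forall i, (i < N)%N -> v i = 0.
Proof.
move=> v0 k kN; pose a : 'rV[C]_N := \row_j j%:R.
have unitM : Vandermonde N a \in unitmx.
  rewrite unitmxE det_Vandermonde unitfE; apply/prodf_neq0 => i _.
  apply/prodf_neq0 => j ij; rewrite !mxE subr_eq0 eqr_nat.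
  by rewrite neq_ltn ij orbT.
have MV i j : Vandermonde N a i j = j%:R ^+ i by rewrite !mxE.
transitivity (\sum_i (Vandermonde N a *m invmx (Vandermonde N a)) i (Ordinal kN) *: v i).
  rewrite mulmxV // (bigD1 (Ordinal kN)) //= mxE eqxx scale1r big1 ?addr0 // => i.
  by rewrite mxE => /negPf ->; rewrite scale0r.
under eq_bigr do rewrite mxE scaler_suml.
rewrite exchange_big big1 //= => j _.
under eq_bigr do rewrite MV mulrC -scalerA.
by rewrite -scaler_sumr v0 scaler0.
Qed.

(** * The tensor product seen through its entries, and the centralizer of the derivations *)

Section TensorEntries.
Variables (C : numFieldType) (m n : nat).
Variables (U : algType C) (iota : {linear 'M[C]_(m + n) -> U}).
Hypothesis U_env : is_enveloping iota.
Variables (T : algType C) (t : Dprime C m n -> U -> T).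
Hypothesis T_tensor : is_super_tensor (@D_homog C m n) (env_homog iota) t.
Local Notation mon := (mon m n).
Local Notation D := (Dprime C m n).
Local Notation O := (zero_idx m n).
Local Notation t0 := (t0pow m n).
Local Notation e i j := (iota (delta_mx i j)).
Local Notation hom := (env_homog iota).

Let t_linl a : linear (t^~ a). Proof. by case: T_tensor => -[]. Qed.
Let t_linr d : linear (t d). Proof. by case: T_tensor => -[]. Qed.

Lemma tensorDl d d' a : t (d + d') a = t d a + t d' a.
Proof. by have := t_linl a 1 d d'; rewrite !scale1r. Qed.
Lemma tensorDr d a a' : t d (a + a') = t d a + t d a'.
Proof. by have := t_linr d 1 a a'; rewrite !scale1r. Qed.
Lemma tensor0l a : t 0 a = 0.
Proof. by have := t_linl a (-1) 0 0; rewrite scaler0 addr0 scaleN1r addNr. Qed.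
Lemma tensor0r d : t d 0 = 0.
Proof. by have := t_linr d (-1) 0 0; rewrite scaler0 addr0 scaleN1r addNr. Qed.
Lemma tensorZl k d a : t (k *: d) a = k *: t d a.
Proof. by rewrite -[k *: d]addr0 t_linl tensor0l addr0. Qed.
Lemma tensorZr k d a : t d (k *: a) = k *: t d a.
Proof. by rewrite -[k *: a]addr0 t_linr tensor0r addr0. Qed.

Lemma tensor_mul p q a b c d : hom p b -> D_homog q c ->
  t a b * t c d = (-1) ^+ (p && q) *: t (a * c) (b * d).
Proof. by case: T_tensor => _ _ tM _; exact: tM. Qed.

(** The universal property maps [T] to the subspace defined by [P]; uniqueness identifies the
    composite with the inclusion with the identity. *)
Lemma tensor_ind (P : T -> Prop) : (forall d a, P (t d a)) ->
  (forall a x y, P x -> P y -> P (a *: x + y)) -> forall w, P w.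
Proof.
move=> Pt Plin w; case: T_tensor => t_bil _ _ t_univ.
have clP : submodule P by split=> //; rewrite -(tensor0l 0).
pose f d a := in_sub_lmod clP (Pt d a).
have f_bil : bilinear_map f.
  by split=> [a|d] k x y; apply: val_inj; rewrite linearP; [exact: t_linl|exact: t_linr].
have [g gE _] := t_univ _ f f_bil.
pose vg : {linear T -> T} := (\val : sub_lmod clP -> T) \o g.
have [g0 _ g0u] := t_univ _ t t_bil.
have E : vg =1 idfun.
  move=> x; rewrite (g0u vg) => [|d a]; last by rewrite /= gE.
  by rewrite (g0u idfun).
by rewrite -[w]E; exact: sub_lmodP.
Qed.

Lemma tensor_homog_ind (P : T -> Prop) :
  (forall p q d a, D_homog q d -> hom p a -> P (t d a)) ->
  (forall a x y, P x -> P y -> P (a *: x + y)) -> forall w, P w.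
Proof.
move=> Pt Plin; have PD x y : P x -> P y -> P (x + y).
  by rewrite -[x in x + _]scale1r; exact: Plin.
apply: tensor_ind => // d a; have [d0 [d1 [hd0 hd1 ->]]] := D_split d.
have [a0 [a1 [ha0 ha1 ->]]] := env_split U_env a.
rewrite tensorDl !tensorDr; apply: (PD); apply: (PD).
- exact: Pt hd0 ha0.
- exact: Pt hd0 ha1.
- exact: Pt hd1 ha0.
- exact: Pt hd1 ha1.
Qed.

(** Entries are taken in the first factor only, so elements of [T] become matrices over [U] indexed
    by monomials. *)
Lemma entries_exist : exists E : mon -> mon -> {linear T -> U},
  forall x y d a, E x y (t d a) = ent x y d *: a.
Proof.
have H (xy : mon * mon) : exists E : {linear T -> U}, forall d a, E (t d a) = ent xy.1 xy.2 d *: a.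
  case: T_tensor => _ _ _ t_univ.
  have f_bil : bilinear_map (fun (d : D) (a : U) => ent xy.1 xy.2 d *: a).
    split=> [a|d] k x y; first by rewrite ent_lin scalerDl scalerA.
    by rewrite scalerDr !scalerA mulrC.
  by have [g gE _] := t_univ _ _ f_bil; exists g.
have [E EE] := choice H.
by exists (fun x y => E (x, y)) => x y d a; exact: EE (x, y) d a.
Qed.

Variable E : mon -> mon -> {linear T -> U}.
Hypothesis E_t : forall x y d a, E x y (t d a) = ent x y d *: a.
Variable sigma : {lrmorphism U -> U}.
Hypothesis sigmaE : forall b x, hom b x -> sigma x = (-1) ^+ b *: x.

(* If [d] has a nonzero entry, the vanishing of that entry of [w] expresses [a] through
   the other terms, which shortens a decomposition of [w] starting with [t d a]. *)
Lemma entries_inj w : (forall x y, E x y w = 0) -> w = 0.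
Proof.
have [s ->] : exists s : seq (D * U), w = \sum_(p <- s) t p.1 p.2.
  elim/tensor_ind: w => [d a|k x y [r ->] [s ->]].
    by exists [:: (d, a)]; rewrite big_seq1.
  exists ([seq (k *: p.1, p.2) | p <- r] ++ s).
  rewrite big_cat big_map scaler_sumr; congr (_ + _).
  by apply: eq_bigr => p _; rewrite tensorZl.
have [k] := ubnP (size s); elim: k s => // k IH [|[d a] s] /=; first by rewrite big_nil.
rewrite ltnS => sk Es; have [d0|dn] := pselect (forall x y, ent x y d = 0).
  have : d = 0.
    by apply: ent_eq => x y; rewrite d0; exact/esym/coeff0.
  move=> dz; rewrite big_cons dz tensor0l add0r; apply: IH => // x y.
  by have := Es x y; rewrite big_cons dz tensor0l add0r.
have [x [y xy]] : exists x y, ent x y d != 0.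
  apply: contrapT => no; case: dn => x y; apply: contrapT => /eqP xy.
  by case: no; exists x, y.
pose r p := - (ent x y p / ent x y d).
have aE : a = \sum_(p <- s) r p.1 *: p.2.
  have := Es x y; rewrite big_cons linearD /= E_t linear_sum /= => /eqP.
  rewrite addr_eq0 => /eqP /(congr1 (fun b => (ent x y d)^-1 *: b)).
  rewrite scalerA mulVf // scale1r => ->; rewrite scalerN scaler_sumr -sumrN.
  by apply: eq_bigr => p _; rewrite E_t scalerA -scaleNr mulrC.
have dsE : \sum_(p <- (d, a) :: s) t p.1 p.2 =
    \sum_(p <- [seq (r p.1 *: d + p.1, p.2) | p <- s]) t p.1 p.2.
  rewrite big_cons /= {1}aE big_map; elim: (s) => [|p s' IHs].
    by rewrite !big_nil tensor0r addr0.
  rewrite !big_cons tensorDr addrACA IHs tensorDl tensorZl tensorZr.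
  by [].
by rewrite dsE in Es *; apply: IH; rewrite ?size_map.
Qed.

Lemma tensor_left1 d d' a : t d 1 * t d' a = t (d * d') a.
Proof.
have [d0 [d1 [h0 h1 ->]]] := D_split d'; have h := eh_one iota.
rewrite tensorDl mulrDr (tensor_mul _ _ h h0) (tensor_mul _ _ h h1).
by rewrite !expr0 !scale1r !mul1r -tensorDl -mulrDr.
Qed.

(** The sign of moving an operator of parity [b] past [a], in a form that makes sense for
    inhomogeneous [a]. *)
Definition twist (b : bool) (a : U) : U := if b then sigma a else a.

Lemma tensor_right1 q d d' a : D_homog q d -> t d' a * t d 1 = t (d' * d) (twist q a).
Proof.
move=> hd; have [a0 [a1 [h0 h1 ->]]] := env_split U_env a.
rewrite tensorDr mulrDl (tensor_mul _ _ h0 hd) (tensor_mul _ _ h1 hd) !mulr1.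
rewrite expr0 scale1r andTb /twist; case: q {hd}; last by rewrite scale1r tensorDr.
by rewrite rmorphD /= (sigmaE h0) (sigmaE h1) scale1r tensorDr tensorZr.
Qed.

Lemma tensor_right_env d a b : t d a * t 1 b = t d (a * b).
Proof.
have [a0 [a1 [h0 h1 ->]]] := env_split U_env a; have h := @D_homog1 C m n.
rewrite tensorDr !mulrDl (tensor_mul _ _ h0 h) (tensor_mul _ _ h1 h) !andbF.
by rewrite !expr0 !scale1r !mulr1 -tensorDr.
Qed.

Lemma entry_left1 k x y x' d : (forall d', ent x y (d * d') = k * ent x' y d') ->
  forall w, E x y (t d 1 * w) = k *: E x' y w.
Proof.
move=> kE; elim/tensor_ind => [d' a|a v w IHv IHw].
  by rewrite tensor_left1 !E_t kE scalerA.
by rewrite mulrDr -scalerAr !linearP /= IHv IHw.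
Qed.

Lemma twist_lin q k a b : twist q (k *: a + b) = k *: twist q a + twist q b.
Proof. by case: q => //=; rewrite linearP. Qed.

Lemma twist0 q : twist q 0 = 0.
Proof. by case: q => //=; rewrite rmorph0. Qed.

Lemma twistZ q k a : twist q (k *: a) = k *: twist q a.
Proof. by rewrite -[k *: a]addr0 twist_lin twist0 addr0. Qed.

Lemma entry_right1 k q x y y' d : D_homog q d ->
  (forall d', ent x y (d' * d) = k * ent x y' d') ->
  forall w, E x y (w * t d 1) = twist q (k *: E x y' w).
Proof.
move=> hd kE; elim/tensor_ind => [d' a|a v w IHv IHw].
  by rewrite (tensor_right1 _ _ hd) !E_t kE !twistZ scalerA.
by rewrite mulrDl -scalerAl !linearP /= IHv IHw -twist_lin.
Qed.

Lemma entry_right_env x y w b : E x y (w * t 1 b) = E x y w * b.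
Proof.
elim/tensor_ind: w => [d a|a v w IHv IHw].
  by rewrite tensor_right_env !E_t scalerAl.
by rewrite mulrDl -scalerAl !linearP /= IHv IHw mulrDl scalerAl.
Qed.

(** The sign rule leaves no trace, because an odd operator has no entry from a power of $t_0$ to the
    same power. *)
Lemma entry_left_env p u w b : hom p b ->
  E (t0 u) (t0 u) (t 1 b * w) = b * E (t0 u) (t0 u) w.
Proof.
move=> hb; elim/tensor_homog_ind: w => [p' q d a hd ha|a v w IHv IHw].
  rewrite (tensor_mul _ _ hb hd) mul1r linearZ /= !E_t; case: q hd => hd.
    by rewrite ent_odd // !scale0r scaler0 mulr0.
  by rewrite andbF scale1r scalerAr.
by rewrite mulrDr -scalerAr !linearP /= IHv IHw mulrDr scalerAr.
Qed.

Lemma Euler_pow_even i : D_homog false (Euler C m n ^+ i).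
Proof.
elim: i => [|i IH]; first exact: D_homog1.
by rewrite exprS; exact: (D_homogM (@D_homog_Euler C m n) IH).
Qed.

(** Both factors are even, the second by [central_even], so no signs arise and centrality is checked
    factor by factor. *)
Lemma tensor_central i z : central z -> central (t (Euler C m n ^+ i) z).
Proof.
move=> zC w; have hz := central_even U_env zC; have hE := @Euler_pow_even i.
elim/tensor_homog_ind: w => [p q d a hd ha|a v w IHv IHw].
  rewrite (tensor_mul _ _ hz hd) (tensor_mul _ _ ha hE) andbF !scale1r zC.
  by rewrite (commrX i (esym (Euler_central d) : GRing.comm d _)).
by rewrite mulrDr mulrDl -scalerAr -scalerAl IHv IHw.
Qed.

Lemma E_sum_central N z : (forall i, central (z i)) -> central (E_sum t N z).
Proof.
move=> zC w; rewrite /E_sum mulr_suml mulr_sumr; apply: eq_bigr => i _.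
exact: tensor_central.
Qed.

Lemma entry_E_sum u N z w :
  E (t0 u) (t0 u) (w * E_sum t N z) =
  \sum_(i < N) (u%:~R : C) ^+ i *: (E (t0 u) (t0 u) w * z i).
Proof.
rewrite /E_sum mulr_sumr linear_sum; apply: eq_bigr => i _ /=.
have -> : t (Euler C m n ^+ i) (z i) = t (Euler C m n ^+ i) 1 * t 1 (z i).
  by rewrite tensor_right_env mul1r.
rewrite mulrA entry_right_env (entry_right1 (@Euler_pow_even i) (fun d => ent_Euler d u i)).
by rewrite scalerAl.
Qed.

Definition commutes_with_derivations (w : T) : Prop :=
  (forall i, w * t (D_p C (up i)) 1 = t (D_p C (up i)) 1 * w) /\
  w * t (D_p C O) 1 = t (D_p C O) 1 * w.

(* An operator commuting with the derivations t_0 d_i is determined by its action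
   on the powers of t_0. *)
Lemma vacuum_determines w : commutes_with_derivations w ->
  (forall u, E (t0 u) (t0 u) w = 0) -> w = 0.
Proof.
move=> [w_p w_O] w0; apply: entries_inj => x y.
(* Commuting with an operator diagonal on monomials kills the entries between different eigenvalues.
   It is used for the total degree and for the exponent of $t_0$, which together identify a power of
   $t_0$. *)
have eig (d : D) (k : mon -> int) : D_homog false d ->
    (forall x y d', ent x y (d * d') = (k x)%:~R * ent x y d') ->
    (forall x y d', ent x y (d' * d) = (k y)%:~R * ent x y d') ->
    w * t d 1 = t d 1 * w -> forall x y, k x != k y -> E x y w = 0.
  move=> hd dl dr wd x' y' kxy; have /eqP : ((k x')%:~R - (k y')%:~R) *: E x' y' w = 0 :> U.
    rewrite scalerBl -(entry_left1 (dl x' y')) -wd (entry_right1 hd (dr x' y')).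
    by rewrite subrr.
  by rewrite scaler_eq0 subr_eq0 eqr_int (negPf kxy) => /eqP.
have w_Euler : w * t (Euler C m n) 1 = t (Euler C m n) 1 * w.
  have := @tensor_central 1%N 1 (fun x => etrans (mul1r x) (esym (mulr1 x))) w.
  by rewrite expr1 => ->.
have deg_eq := eig _ _ (@D_homog_Euler C m n) (@ent_Euler_left C m n) (@ent_Euler_right C m n) w_Euler.
have exp_eq := eig _ (fun x : mon => x.1.1) (@D_homog_p_zero C m n) (@ent_p_zero_left C m n)
  (@ent_p_zero_right C m n) w_O.
have [h] := ubnP (height x); elim: h x y => // h IH x y; rewrite ltnS => xh.
have [x0|no] := pselect (exists i, occurs i x); last first.
  have -> : x = t0 x.1.1.
    by apply: no_occurs => i; apply/negP => xi; case: no; exists i.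
  have [k|k] := eqVneq x.1.1 y.1.1; last by apply: exp_eq.
  have [/height_eq0 ->|hy] := eqVneq (height y) 0%N; first by rewrite -k w0.
  apply: deg_eq; rewrite !mdeg_height /= -k.
  rewrite (inj_eq (addrI _)); apply: contraNneq hy => -[<-].
  by rewrite /height cards0 big1 // => i _; rewrite ffunE.
case: x0 => i xi; have [q hq] := D_homog_p C (up i).
have [k k0 [kl kr]] := ent_p_occurs C i.
(* This entry of the commutation relation expresses a nonzero multiple of [E x y w] through an entry
   in the row [remove i x], of smaller height. *)
have := congr1 (E (remove i x) y) (w_p i).
rewrite (entry_right1 hq (kr _ _)) (entry_left1 (kl x y ^~ xi)).
rewrite IH ?scaler0 ?twist0; last exact: leq_trans (height_remove xi) xh.
have kx : k x != 0 by rewrite k0.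
by move/esym/eqP; rewrite scaler_eq0 (negPf kx) => /eqP.
Qed.

Lemma vacuum_polynomial w : exists N (z : nat -> U), forall u : int,
  E (t0 u) (t0 u) w = \sum_(i < N) (u%:~R : C) ^+ i *: z i.
Proof.
elim/tensor_ind: w => [d a|k v w [N [z zE]] [N' [z' z'E]]].
  have [q qE] := vacuum_poly d; exists (size q), (fun i => q`_i *: a) => u.
  rewrite E_t qE horner_coef scaler_suml; apply: eq_bigr => i _.
  by rewrite scalerA mulrC.
pose z0 M (f : nat -> U) i := if (i < M)%N then f i else 0.
have pad M (f : nat -> U) (u : int) : (M <= maxn N N')%N ->
    \sum_(i < M) (u%:~R : C) ^+ i *: f i = \sum_(i < maxn N N') u%:~R ^+ i *: z0 M f i.
  move=> le; rewrite (big_ord_widen _ (fun i => u%:~R ^+ i *: f i) le) big_mkcond.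
  by apply: eq_bigr => i _; rewrite /z0; case: ifP; rewrite ?scaler0.
exists (maxn N N'), (fun i => k *: z0 N z i + z0 N' z' i) => u.
rewrite linearP /= zE z'E (pad _ z) ?leq_maxl // (pad _ z') ?leq_maxr // scaler_sumr -big_split.
by apply: eq_bigr => i _ /=; rewrite scalerDr !scalerA mulrC.
Qed.

(** The candidate is the polynomial of vacuum entries with [u] replaced by the Euler operator, which
    acts on $t_0^u$ by [u]. Candidate and [w] both commute with the derivations and agree on the
    vacuum. *)
Lemma centralizer w : commutes_with_derivations w ->
  (forall a b, let x := t (D_tp C (up a) (up b)) 1 + t 1 (e a b) in w * x = x * w) ->
  in_CE_Z t w.
Proof.
move=> w_p w_e; have [N [z zE]] := vacuum_polynomial w.
have W_e a b u : E (t0 u) (t0 u) w * e a b = e a b * E (t0 u) (t0 u) w.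
  have := congr1 (E (t0 u) (t0 u)) (w_e a b).
  rewrite mulrDr mulrDl !linearD /= entry_right_env (entry_left_env _ _ (homog_e iota a b)).
  have [q hq] := D_homog_tp C (up a) (up b).
  rewrite (entry_left1 (k := 0) (x' := t0 u)) ?scale0r ?add0r; last first.
    by move=> d; rewrite mul0r; exact: ent_tp_left.
  rewrite (entry_right1 (k := 0) (y' := t0 u) hq) ?scale0r ?twist0 ?add0r //.
  by move=> d; rewrite mul0r; exact: ent_tp_right.
have W_central u : central (E (t0 u) (t0 u) w).
  move=> x; elim/(env_ind U_env): x => [|a x y IHx IHy|i j x IHx].
  - by rewrite mulr1 mul1r.
  - by rewrite mulrDr mulrDl -scalerAr -scalerAl IHx IHy.
  - by rewrite mulrA W_e -mulrA IHx mulrA.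
(* Coefficients beyond [N] are unconstrained and are set to 0, as [in_CE_Z] asks all of them to be
   central. *)
pose z0 i := if (i < N)%N then z i else 0.
have z0C i : central (z0 i).
  rewrite /z0; case: ltnP => iN x; last by rewrite mulr0 mul0r.
  apply/eqP; rewrite -subr_eq0; apply/eqP.
  (* The commutator of the vacuum entry with [x] vanishes for every [u], hence so does each of its
     coefficients in [u]. *)
  apply: (@powers_independent C U N (fun i => z i * x - x * z i)) => // u.
  have := W_central u x; rewrite zE mulr_suml mulr_sumr => /eqP.
  rewrite -subr_eq0 -sumrB => /eqP E0; rewrite -[RHS]E0; apply: eq_bigr => j _.
  by rewrite scalerBr -scalerAl -scalerAr.
exists N, z0; split=> //; apply/eqP; rewrite -subr_eq0; apply/eqP.
apply: vacuum_determines.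
  have sC := E_sum_central N z0C.
  by case: w_p => w_p w_O; split=> [i|]; rewrite mulrBl mulrBr ?w_p ?w_O sC.
move=> u; rewrite linearB /= -[E_sum _ _ _]mul1r entry_E_sum zE -sumrB big1 // => i _.
have h1 : E (t0 u) (t0 u) 1 = 1.
  case: T_tensor => _ <- _ _; by rewrite E_t ent1 eqxx scale1r.
by rewrite h1 mul1r /z0 ltn_ord subrr.
Qed.
End TensorEntries.

(** * The composed functional on the larger enveloping algebra *)

Section PhiFunctional.
Variables (C : numFieldType) (m n : nat).
Variables (U : algType C) (iota : {linear 'M[C]_(m + n) -> U}).
Hypothesis U_env : is_enveloping iota.
Variables (T : algType C) (t : Dprime C m n -> U -> T).
Hypothesis T_tensor : is_super_tensor (@D_homog C m n) (env_homog iota) t.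
Variable chi : U -> {mpoly C[m + n]}.
Hypothesis chi_hc : is_harish_chandra iota chi.
Variable E : mon m n -> mon m n -> {linear T -> U}.
Hypothesis E_t : forall x y d a, E x y (t d a) = ent x y d *: a.
Variable sigma : {lrmorphism U -> U}.
Hypothesis sigmaE : forall b x, env_homog iota b x -> sigma x = (-1) ^+ b *: x.
Variables (U' : algType C) (iota' : {linear 'M[C]_(m.+1 + n) -> U'}).
Variables (phi : {lrmorphism U' -> T}) (N : nat) (z : nat -> U).
Hypothesis zC : forall i, central (z i).
Local Notation R := (E_sum t N z).
Hypothesis phi_R : is_phi iota t R iota' phi.
Variables (lam : 'I_(m + n) -> C) (c : U -> C) (u : int).
Hypothesis c_hc : hc_functional iota lam c.
Local Notation e i j := (iota (delta_mx i j)).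
Local Notation O := (zero_idx m n).
Local Notation t0 := (t0pow m n u).

(** The scalar by which $\sum_i \mathcal{E}^i \otimes y_i$ acts on $t_0^u \otimes v_\lambda$. *)
Definition central_value (M : nat) (y : nat -> U) : C :=
  \sum_(i < M) u%:~R ^+ i * (chi (y i)).@[fun i => lam i + rho C i].

Let r := central_value N z.

Definition phi_weight (i : 'I_(m.+1 + n)) : C :=
  if unlift ord0 i is Some k then lam k + (-1) ^+ par (k : 'I_(m + n)) * r
  else u%:~R + r.

Let W w := c (E t0 t0 w).

Let c0 : c 0 = 0.
Proof. by have := hc_lin c_hc (-1) 0 0; rewrite scaler0 addr0 mulN1r addNr. Qed.
Let cD x y : c (x + y) = c x + c y.
Proof. by rewrite -[x]scale1r (hc_lin c_hc) scale1r mul1r. Qed.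
Let cZ a x : c (a *: x) = a * c x.
Proof. by rewrite -[_ *: _]addr0 (hc_lin c_hc) c0 addr0. Qed.

Let WD v w : W (v + w) = W v + W w.
Proof. by rewrite /W linearD /= cD. Qed.
Let WZ a v : W (a *: v) = a * W v.
Proof. by rewrite /W linearZ /= cZ. Qed.
Let W0 : W 0 = 0. Proof. by rewrite /W linear0 c0. Qed.
Let WN v : W (- v) = - W v.
Proof. by rewrite -scaleN1r WZ mulN1r. Qed.

Let W_E_sum M y w : (forall i, central (y i)) ->
  W (w * E_sum t M y) = central_value M y * W w.
Proof.
move=> yC; rewrite /W (entry_E_sum U_env T_tensor E_t sigmaE).
rewrite (big_morph c cD c0) /central_value mulr_suml; apply: eq_bigr => i _.
by rewrite cZ (hc_functional_central U_env c_hc chi_hc) // mulrA.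
Qed.

Let WR w : W (w * R) = r * W w.
Proof. exact: W_E_sum. Qed.

Let RW w : W (R * w) = r * W w.
Proof. by rewrite -WR (E_sum_central U_env T_tensor N zC). Qed.

Let W_left0 p d b w : (forall d', ent t0 t0 (d * d') = 0) -> env_homog iota p b ->
  W (t d b * w) = 0.
Proof.
move=> d0 hb; rewrite /W; suff -> : E t0 t0 (t d b * w) = 0 by [].
elim/(tensor_homog_ind U_env T_tensor): w => [p' q d' a hd ha|a v w IHv IHw].
  by rewrite (tensor_mul T_tensor _ _ hb hd) linearZ /= E_t d0 scale0r scaler0.
by rewrite mulrDr -scalerAr linearP /= IHv IHw scaler0 addr0.
Qed.

Let W_right0 q d w : D_homog q d -> (forall d', ent t0 t0 (d' * d) = 0) ->
  W (w * t d 1) = 0.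
Proof.
move=> hd d0; rewrite /W (entry_right1 U_env T_tensor E_t sigmaE (k := 0) (y' := t0) hd).
  by rewrite scale0r twist0.
by move=> d'; rewrite d0 mul0r.
Qed.

Lemma phi_hc_functional :
  hc_functional (m := m.+1) (n := n) iota' phi_weight (fun x => W (phi x)).
Proof.
case: phi_R => phi_ab phi_a0 phi_0b phi_00.
have h1 := eh_one iota.
have weight_up a : phi_weight (up a) = lam a + (-1) ^+ par a * r.
  by rewrite /phi_weight /up liftK.
have weight_0 : phi_weight O = u%:~R + r by rewrite /phi_weight unlift_none.
have W_tp_r a b w : W (w * t (D_tp C (up a) (up b)) 1) = 0.
  have [q hq] := D_homog_tp C (up a) (up b).
  by apply: W_right0 hq _ => d; exact: ent_tp_right.
have W_tp_l a j w : W (t (D_tp C (up a) j) 1 * w) = 0.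
  by apply: W_left0 h1 => d; exact: ent_tp_left.
have W_e_r x w : W (w * t 1 x) = c (E t0 t0 w * x).
  by rewrite /W (entry_right_env U_env T_tensor E_t).
have W_e_l a b w : W (t 1 (e a b) * w) = c (e a b * E t0 t0 w).
  by rewrite /W (entry_left_env U_env T_tensor E_t _ _ (homog_e iota a b)).
have sign_par (a : 'I_(m + n)) : (-1) ^+ (par a && par a) = (-1) ^+ par a :> C.
  by rewrite andbb.
have W_ab_r a b x : W (phi x * phi (iota' (delta_mx (up a) (up b)))) =
    c (E t0 t0 (phi x) * e a b) + (a == b)%:R * (-1) ^+ par a * r * W (phi x).
  rewrite phi_ab !mulrDr !WD W_tp_r add0r W_e_r -scalerAr WZ WR !mulrA; congr (_ + _).
  by case: eqVneq => [->|_]; rewrite ?sign_par // !mul0r.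
have W_ab_l a b x : W (phi (iota' (delta_mx (up a) (up b))) * phi x) =
    c (e a b * E t0 t0 (phi x)) + (a == b)%:R * (-1) ^+ par a * r * W (phi x).
  rewrite phi_ab !mulrDl !WD W_tp_l add0r W_e_l -scalerAl WZ RW !mulrA; congr (_ + _).
  by case: eqVneq => [->|_]; rewrite ?sign_par // !mul0r.
have neq_ij (i j : 'I_(m + n)) : (i < j)%N -> (i == j) = false.
  by move=> ij; rewrite -val_eqE ltn_eqF.
have neq_ji (i j : 'I_(m + n)) : (j < i)%N -> (i == j) = false.
  by move=> ij; rewrite -val_eqE gtn_eqF.
split.
- move=> a x y; rewrite (_ : phi _ = a *: phi x + phi y); last exact: linearP.
  by rewrite WD WZ.
- rewrite rmorph1 /W; case: T_tensor => _ <- _ _.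
  by rewrite E_t ent1 eqxx scale1r (hc_one c_hc).
- move=> x i j; rewrite rmorphM /=.
  case: (unliftP ord0 j) => [b|] -> //; case: (unliftP ord0 i) => [a|] -> ij.
    rewrite -![fintype.lift _ _]/(up _) W_ab_r (hc_raise c_hc) // neq_ij // !mul0r.
    by rewrite addr0.
  rewrite -[fintype.lift _ _]/(up _) -[ord0]/O phi_0b.
  have [q hq] := D_homog_p C (up b).
  by apply: W_right0 hq _ => d; exact: ent_p_right.
- move=> x i j; rewrite rmorphM /=.
  case: (unliftP ord0 i) => [a|] -> //; case: (unliftP ord0 j) => [b|] -> ij.
    rewrite -![fintype.lift _ _]/(up _) W_ab_l (hc_lower c_hc) // neq_ji // !mul0r.
    by rewrite addr0.
  (* Every term in the image of $e_{a0}$ starts with a multiplication by some $t_j$, $j \in I$, so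
     nothing remains on the power of $t_0$. *)
  rewrite -[fintype.lift _ _]/(up _) -[ord0]/O phi_a0 mulrBl WD WN W_tp_l.
  rewrite mulr_suml (big_morph W WD W0) big1 ?subr0 // => k _.
  rewrite -scalerAl WZ (W_left0 _ _ (homog_e iota a k)) ?mulr0 // => d.
  exact: ent_t_left.
- move=> x i; rewrite rmorphM /=; case: (unliftP ord0 i) => [a|] ->.
    rewrite -[fintype.lift _ _]/(up _) W_ab_r weight_up eqxx mul1r (hc_diagr c_hc).
    by rewrite mulrDl.
  rewrite -[ord0]/O phi_00 weight_0 mulrDr WD WR mulrDl; congr (_ + _).
  rewrite /W (entry_right1 U_env T_tensor E_t sigmaE (@D_homog_p_zero C m n) (@ent_p_zero_right C m n _ _)).
  by rewrite cZ.
- move=> x i; rewrite rmorphM /=; case: (unliftP ord0 i) => [a|] ->.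
    rewrite -[fintype.lift _ _]/(up _) W_ab_l weight_up eqxx mul1r (hc_diagl c_hc).
    by rewrite mulrDl.
  rewrite -[ord0]/O phi_00 weight_0 mulrDl WD RW mulrDl; congr (_ + _).
  rewrite /W (entry_left1 T_tensor E_t (@ent_p_zero_left C m n _ _)).
  by rewrite cZ.
Qed.

Lemma phi_value x M y : (forall i, central (y i)) -> phi x = E_sum t M y ->
  W (phi x) = central_value M y.
Proof.
move=> yC ->; rewrite -[E_sum _ _ _]mul1r W_E_sum // /W.
by case: T_tensor => _ <- _ _; rewrite E_t ent1 eqxx scale1r (hc_one c_hc) mulr1.
Qed.
End PhiFunctional.

(** * Evaluation of polynomials at the highest weights *)

Section Evaluation.
Variables (C : numFieldType) (m n : nat).

Definition eval_at (u : int) (x : 'I_(m + n) -> C) : {poly {mpoly C[m + n]}} -> C :=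
  horner_eval (u%:~R : C) \o map_poly (meval x).
HB.instance Definition _ u x := GRing.RMorphism.on (eval_at u x).

Lemma eval_at_polyC u x q : eval_at u x q%:P = q.@[x].
Proof. by rewrite /eval_at /= map_polyC /horner_eval hornerC. Qed.

Lemma eval_at_X u x : eval_at u x 'X = u%:~R.
Proof. by rewrite /eval_at /= map_polyX /horner_eval hornerX. Qed.

Lemma eval_at_tau u x l p : eval_at u x (tau l p) =
  p.@[fun k : 'I_(m.+1 + n) =>
        if unlift ord0 k is Some i
        then x i + (-1) ^+ par (i : 'I_(m + n)) * eval_at u x l
        else u%:~R + eval_at u x l + m.+1%:R].
Proof.
rewrite /tau rmorph_mmap /meval; congr (mmap _ _ _); apply/funext => k /=.
  by rewrite eval_at_polyC mevalC.
case: unlift => [i|] /=; rewrite !rmorphD /=.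
  by rewrite eval_at_polyC mevalXU rmorphM rmorph_sign.
by rewrite eval_at_X rmorph_nat.
Qed.

(** At a fixed weight, agreement at all natural [u] forces equality as polynomials in $\ell_0$;
    density of the weights then applies to each coefficient. *)
Lemma eval_at_ext (U : algType C) (iota : {linear 'M[C]_(m + n) -> U})
    (f g : {poly {mpoly C[m + n]}}) : is_enveloping iota ->
  (forall lam c (u : int), hc_functional iota lam c ->
     eval_at u (fun i => lam i + rho C i) f = eval_at u (fun i => lam i + rho C i) g) ->
  f = g.
Proof.
move=> U_env fg; apply/eqP; rewrite -subr_eq0; apply/eqP/polyP => i; rewrite coef0.
apply: (hc_functional_dense U_env) => lam c c_hc.
pose x i : C := lam i + rho C i.
suff : map_poly (meval x) (f - g) = 0.
  by move/(congr1 (fun q : {poly C} => q`_i)); rewrite coef_map coef0.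
apply: (@poly_many_roots _ _ (fun k : nat => k%:R) 0) => [j k /eqP|k _].
  by rewrite eqr_nat => /eqP.
apply/rootP; have := fg lam c k c_hc => /eqP.
by rewrite -subr_eq0 -rmorphB => /eqP.
Qed.
End Evaluation.

(** * Images of central elements and their Harish-Chandra polynomials *)

Section Main.
Variables (C : numFieldType) (m n : nat).
Variables (U : algType C) (iota : {linear 'M[C]_(m + n) -> U}).
Hypothesis U_env : is_enveloping iota.
Variables (U' : algType C) (iota' : {linear 'M[C]_(m.+1 + n) -> U'}).
Hypothesis U'_env : is_enveloping (m := m.+1) (n := n) iota'.
Variables (T : algType C) (t : Dprime C m n -> U -> T).
Hypothesis T_tensor : is_super_tensor (@D_homog C m n) (env_homog iota) t.
Variables (R : T) (R_CE_Z : in_CE_Z t R).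
Variable phi : {lrmorphism U' -> T}.
Hypothesis phi_R : is_phi iota t R iota' phi.

(** Because [R] is central, it cancels from the commutation with the images of $e_{00}$ and
    $e_{ab}$, leaving the relations that [centralizer] asks for. *)
Lemma phi_central z : central z -> in_CE_Z t (phi z).
Proof.
move=> zC; case: phi_R => phi_ab _ phi_0b phi_00.
have [N [y [yC RE]]] := R_CE_Z.
have RC : central R by rewrite RE; exact: (E_sum_central U_env T_tensor).
have phiC x : phi z * phi x = phi x * phi z by rewrite -!rmorphM zC.
have [E E_t] := entries_exist T_tensor.
have [sigma sigmaE] := env_sigma U_env.
apply: (centralizer U_env T_tensor E_t sigmaE).
  split=> [i|]; first by rewrite -phi_0b phiC.
  have := phiC (iota' (delta_mx (zero_idx m n) (zero_idx m n))).
  by rewrite phi_00 mulrDr mulrDl RC => /addIr.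
move=> a b x; have := phiC (iota' (delta_mx (up a) (up b))).
by rewrite phi_ab mulrDr mulrDl -scalerAr -scalerAl RC => /addIr.
Qed.

Variable chi : U -> {mpoly C[m + n]}.
Hypothesis chi_hc : is_harish_chandra iota chi.
Variable chi' : U' -> {mpoly C[m.+1 + n]}.
Hypothesis chi'_hc : is_harish_chandra (m := m.+1) (n := n) iota' chi'.
Variable chi0 : T -> {poly {mpoly C[m + n]}}.
Hypothesis chi0_spec : is_chi0 t chi chi0.

(** The vacuum value of [phi z] is computed twice: through [chi'], since the composed functional is
    a highest weight functional, and through [chi], from the expression of [phi z] in
    $\mathbb{C}[\mathcal{E}] \otimes Z(U)$. *)
Lemma chi0_phi z : central z -> chi0 (phi z) = tau (chi0 R) (chi' z).
Proof.
move=> zC; have [N [y [yC RE]]] := R_CE_Z.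
have [M [w [wC wE]]] := phi_central zC.
have [E E_t] := entries_exist T_tensor.
have [sigma sigmaE] := env_sigma U_env.
apply: (eval_at_ext U_env) => lam c u c_hc.
have chi0_eval L v : (forall i, central (v i)) ->
    eval_at u (fun i => lam i + rho C i) (chi0 (E_sum t L v)) = central_value chi lam u L v.
  move=> vC; rewrite chi0_spec // rmorph_sum; apply: eq_bigr => i _ /=.
  by rewrite rmorphM rmorphXn /= eval_at_X eval_at_polyC.
have phi_R' := phi_R; rewrite RE in phi_R'.
have c'_hc := phi_hc_functional U_env T_tensor chi_hc E_t sigmaE yC phi_R' u c_hc.
have := hc_functional_central U'_env c'_hc chi'_hc zC 1.
rewrite mul1r (hc_one c'_hc) mulr1.
rewrite (phi_value U_env T_tensor chi_hc E_t sigmaE u c_hc wC wE) => val.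
rewrite wE chi0_eval // val eval_at_tau RE chi0_eval //.
(* On $I$ the vector $\rho_{m+1|n}$ restricts to $\rho_{m|n}$; at 0 it equals $m+1$, which is the
   constant in [tau]. *)
congr meval; apply/funext => k; rewrite /phi_weight.
case: (unliftP ord0 k) => [a|] -> /=.
  by rewrite addrAC.
by rewrite /rho /par /= subn0.
Qed.
End Main.

(** * The image of chi_0, and the theorem *)

Section Image.
Variables (C : numFieldType) (m n : nat) (U : algType C).
Variables (T : algType C) (t : Dprime C m n -> U -> T).
Variable chi : U -> {mpoly C[m + n]}.
Hypothesis chi_iso : is_iso_onto_Ih chi.
Variable chi0 : T -> {poly {mpoly C[m + n]}}.
Hypothesis chi0_spec : is_chi0 t chi chi0.

Lemma in_Ih0 : in_Ih (0 : {mpoly C[m + n]}).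
Proof. by split=> [s _|al lam _ _ c]; rewrite ?raddf0 ?meval0. Qed.

Lemma chi0_in_Cl0_Ih w : in_CE_Z t w -> in_Cl0_Ih (chi0 w).
Proof.
case=> N [y [yC ->]] i; rewrite chi0_spec //.
have -> : \sum_(j < N) 'X^j * (chi (y j))%:P = \poly_(j < N) chi (y j).
  by rewrite poly_def; apply: eq_bigr => j _; rewrite -mul_polyC mulrC.
rewrite coef_poly; case: ifP => _; last exact: in_Ih0.
by case: chi_iso => + _ _; apply.
Qed.
End Image.

Theorem theorem5p2 (K : realType) (m n : nat)
  (* U(gl(m|n)), U(gl(m+1|n)) and D'(m|n) ⊗ U(gl(m|n)) *)
  (U : algType K[i]) (iota : {linear 'M[K[i]]_(m + n) -> U})
  (U_env : is_enveloping iota)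
  (U' : algType K[i]) (iota' : {linear 'M[K[i]]_(m.+1 + n) -> U'})
  (U'_env : is_enveloping (m := m.+1) (n := n) iota')
  (T : algType K[i]) (t : Dprime K[i] m n -> U -> T)
  (T_tensor : is_super_tensor (@D_homog K[i] m n) (env_homog iota) t)
  (* Harish-Chandra maps of gl(m|n) and gl(m+1|n) *)
  (chi : U -> {mpoly K[i][m + n]})
  (chi_hc : is_harish_chandra iota chi) (chi_iso : is_iso_onto_Ih chi)
  (chi' : U' -> {mpoly K[i][m.+1 + n]})
  (chi'_hc : is_harish_chandra (m := m.+1) (n := n) iota' chi')
  (chi'_iso : is_iso_onto_Ih (m := m.+1) (n := n) chi')
  (* chi_{0,m|n} and its inverse *)
  (chi0 : T -> {poly {mpoly K[i][m + n]}})
  (chi0_spec : is_chi0 t chi chi0)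
  (chi0inv : {poly {mpoly K[i][m + n]}} -> T)
  (chi0inv_spec : is_inverse_chi0 t chi0 chi0inv)
  (R : T) (R_CE_Z : in_CE_Z t R)
  (phi : {lrmorphism U' -> T}) (phi_R : is_phi iota t R iota' phi) :
  (forall z, central z -> phi z = chi0inv (tau (chi0 R) (chi' z))) /\
  (is_subalgebra (fun w => exists2 z, central z & phi z = w) /\
   forall z, central z -> in_CE_Z t (phi z)) /\
  (forall z, central z ->
     in_Cl0_Ih (tau (chi0 R) (chi' z)) /\
     chi0 (phi z) = tau (chi0 R) (chi' z)).
Proof.
have phiC z : central z -> in_CE_Z t (phi z).
  exact: (phi_central U_env T_tensor R_CE_Z phi_R).
have chi0E z : central z -> chi0 (phi z) = tau (chi0 R) (chi' z).
  exact: (chi0_phi U_env U'_env T_tensor R_CE_Z phi_R chi_hc chi'_hc chi0_spec).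
split; [|split; [split; [split|exact: phiC]|]].
- move=> z zC; rewrite -chi0E //; case: chi0inv_spec => chi0K _ _.
  by rewrite chi0K //; exact: phiC.
- by exists 1; [move=> x; rewrite mul1r mulr1|exact: rmorph1].
- move=> a _ _ [x xC <-] [y yC <-]; exists (a *: x + y); last exact: linearP.
  by move=> w; rewrite mulrDl mulrDr -scalerAl -scalerAr xC yC.
- move=> _ _ [x xC <-] [y yC <-]; exists (x * y); last exact: rmorphM.
  by move=> w; rewrite -mulrA yC mulrA xC mulrA.
(* The supersymmetry of the substituted polynomial is not checked by hand: it is a value of [chi0]
   on $\mathbb{C}[\mathcal{E}] \otimes Z(U)$. *)
- move=> z zC; rewrite -chi0E //; split; last by [].
  exact: (chi0_in_Cl0_Ih chi_iso chi0_spec (phiC z zC)).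
Qed.
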